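(* Let $y\in L^2(0,1)$ and let $(\lambda_k)_{k\ge0}$ be a nondecreasing sequence of positive numbers. For one-dimensional TV-denoising on $(0,1)$, the MHDM iterates coincide with the Tikhonov (TV-denoising) minimizers: $x_k=x_{\lambda_k}$ for all $k\in\mathbb N_0$.
   Context: $|u|_{TV}=\sup\{\int_0^1u\,\varphi'\,dt:\varphi\in C_c^\infty(0,1),\ \|\varphi\|_\infty\le1\}$ is the total variation seminorm on $L^2(0,1)$ (value $+\infty$ allowed). $x_\lambda$ is the unique minimizer in $L^2(0,1)$ of $x\mapsto\frac{\lambda}{2}\|x-y\|_{L^2}^2+|x|_{TV}$. MHDM: $x_0=x_{\lambda_0}$ and, for $k\ge1$, $x_k=\arg\min_{x\in L^2(0,1)}\frac{\lambda_k}{2}\|x-y\|_{L^2}^2+|x-x_{k-1}|_{TV}$ (unique). *)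

(* Defs.v *)
From HB Require Import structures.
From mathcomp Require Import all_boot all_order all_algebra.
From mathcomp Require Import all_classical all_reals all_analysis.
Set Implicit Arguments. Unset Strict Implicit. Unset Printing Implicit Defensive.
Import Order.TTheory GRing.Theory Num.Theory.
Import numFieldNormedType.Exports.
Local Open Scope classical_set_scope.
Local Open Scope ring_scope.

Section Defs.
Variable R : realType.

Definition I01 : set R := `]0%R, 1%R[.

Local Notation mu := (@lebesgue_measure R).

Definition inL2 (x : R -> R) : Prop :=
  measurable_fun I01 x /\ (\int[mu]_(t in I01) ((x t) ^+ 2)%:E < +oo)%E.

Definition L2norm2 (x : R -> R) : \bar R :=
  (\int[mu]_(t in I01) ((x t) ^+ 2)%:E)%E.

Definition smooth_cpt (phi : R -> R) : Prop :=
  (forall (n : nat) (t : R), derivable (derive1n n phi) t 1) /\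
  compact (closure [set t | phi t != 0]) /\
  closure [set t | phi t != 0] `<=` I01.

Definition TV (u : R -> R) : \bar R :=
  ereal_sup [set (\int[mu]_(t in I01) (u t * derive1 phi t)%:E)%E |
             phi in [set phi | smooth_cpt phi /\ forall t, `|phi t| <= 1]].

Definition tikh (lam : R) (y z x : R -> R) : \bar R :=
  ((lam / 2)%:E * L2norm2 (fun t => (x t - y t)%R) + TV (fun t => (x t - z t)%R))%E.

Definition is_minimizer (lam : R) (y z x : R -> R) : Prop :=
  inL2 x /\ forall w, inL2 w -> (tikh lam y z x <= tikh lam y z w)%E.

End Defs.

(* Main.v *)
Require Import Defs.
From HB Require Import structures.
From mathcomp Require Import all_boot all_order all_algebra.
From mathcomp Require Import all_classical all_reals all_analysis.
From mathcomp Require Import measurable_realfun ring lra zify.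
Set Implicit Arguments. Unset Strict Implicit. Unset Printing Implicit Defensive.
Import Order.TTheory GRing.Theory Num.Theory.
Import numFieldNormedType.Exports.
Local Open Scope classical_set_scope.
Local Open Scope ring_scope.

(** A minimizer [x] of [lam / 2 |x - y|^2 + TV (x - z)] is characterized by
    [lam (y - x)] being a subgradient of [TV], the support function of the set
    of derivatives of test functions, at [x - z]; since subgradients are
    monotone, this determines [x].  Hence it suffices that the TV-denoising
    minimizers [x1] and [x2] for [lam1 <= lam2] are nested: [lam2 (y - x2)], a
    subgradient at [x2], is also one at [x2 - x1].  The resolvents being
    nonexpansive and the graph of the subgradient being closed, nestedness
    passes to the limit in [y], which reduces it to step functions.  There
    [lam (y - x)] is the increment of a taut string [F], a sequence with values
    in [[-1, 1]], and [x] can only increase where [F = -1] and only decrease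
    where [F = 1].  A discrete maximum principle gives
    [|F1 / lam1 - F2 / lam2| <= 1 / lam1 - 1 / lam2], so that wherever [F1]
    touches the constraint, [F2] touches it too and the jumps of [x1] and [x2]
    are ordered: every jump of [x2 - x1] has the sign of [-F2].  Smooth test
    functions are obtained from taut strings by gluing monotone steps of almost
    constant slope. *)

(** * Semi-inner product spaces *)

HB.mixin Record Lmodule_isSemiInner (R : rcfType) V of GRing.Lmodule R V := {
  dot : V -> V -> R ;
  dotC : forall u v, dot u v = dot v u ;
  dotDl : forall u v w, dot (u + v) w = dot u w + dot v w ;
  dotZl : forall c u w, dot (c *: u) w = c * dot u w ;
  dot_ge0 : forall u, 0 <= dot u u
}.

#[short(type="semiInnerType")]
HB.structure Definition SemiInner (R : rcfType) :=
  { V of Lmodule_isSemiInner R V & GRing.Lmodule R V }.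

Notation "''[' u , v ]" := (dot u v) : ring_scope.

Section semi_inner_theory.
Variables (R : rcfType) (V : semiInnerType R).
Implicit Types (u v w : V) (c : R).

Lemma dotDr u v w : '[w, u + v] = '[w, u] + '[w, v].
Proof. by rewrite dotC dotDl !(dotC w). Qed.

Lemma dotZr c u w : '[w, c *: u] = c * '[w, u].
Proof. by rewrite dotC dotZl (dotC w). Qed.

Lemma dotNl u w : '[- u, w] = - '[u, w].
Proof. by rewrite -scaleN1r dotZl mulN1r. Qed.

Lemma dotNr u w : '[w, - u] = - '[w, u].
Proof. by rewrite dotC dotNl (dotC w). Qed.

Lemma dotBl u v w : '[u - v, w] = '[u, w] - '[v, w].
Proof. by rewrite dotDl dotNl. Qed.

Lemma dotBr u v w : '[w, u - v] = '[w, u] - '[w, v].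
Proof. by rewrite dotDr dotNr. Qed.

Lemma dot0l w : '[0, w] = 0.
Proof. by rewrite -(scale0r 0) dotZl mul0r. Qed.

Lemma dot_suml n (u : 'I_n -> V) w :
  '[\sum_(i < n) u i, w] = \sum_(i < n) '[u i, w].
Proof.
by apply: (big_morph (fun u => '[u, w])) => [x y|]; rewrite ?dotDl ?dot0l.
Qed.

Let norm u : R := Num.sqrt '[u, u].

Let sqr_normE u : norm u ^+ 2 = '[u, u].
Proof. by rewrite sqr_sqrtr ?dot_ge0. Qed.

Let dot_le_normM u v : '[u, v] <= norm u * norm v.
Proof.
have quad_ge0 s : 0 <= '[u, u] + 2 * s * '[u, v] + s ^+ 2 * '[v, v].
  have := dot_ge0 (u + s *: v).
  by rewrite dotDl !dotDr !dotZl !dotZr (dotC v u); lra.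
rewrite -sqrtrM ?dot_ge0// (le_trans (ler_norm _))// -sqrtr_sqr.
rewrite ler_sqrt ?mulr_ge0 ?dot_ge0//.
have [v0|v0] := eqVneq '[v, v] 0.
  rewrite v0 mulr0; have [->|uv0] := eqVneq '[u, v] 0; first by rewrite expr0n.
  have := quad_ge0 (- (('[u, u] + 1) / (2 * '[u, v]))); rewrite v0 mulr0 addr0.
  by rewrite (_ : _ + _ = -1) ?ler0N1//; field.
have vp : 0 < '[v, v] by rewrite lt_neqAle eq_sym v0 dot_ge0.
have := quad_ge0 (- ('[u, v] / '[v, v])).
rewrite (_ : _ + _ = ('[u, u] * '[v, v] - '[u, v] ^+ 2) / '[v, v]).
  by rewrite pmulr_lge0 ?invr_gt0// subr_ge0.
by field.
Qed.

Let normD_le u v : norm (u + v) <= norm u + norm v.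
Proof.
rewrite -(@ler_pXn2r _ 2) ?nnegrE ?addr_ge0 ?sqrtr_ge0// sqr_normE.
rewrite dotDl !dotDr (dotC v u) sqrrD !sqr_normE.
by have := dot_le_normM u v; lra.
Qed.

Let normZ_sqrt c u : norm (c *: u) = `|c| * norm u.
Proof.
by rewrite /norm dotZl dotZr mulrA -expr2 sqrtrM ?sqr_ge0// sqrtr_sqr.
Qed.

Let normMn_sqrt u n : norm (u *+ n) = norm u *+ n.
Proof. by rewrite -scaler_nat normZ_sqrt normr_nat mulr_natl. Qed.

Let normN_sqrt u : norm (- u) = norm u.
Proof. by rewrite -scaleN1r normZ_sqrt normrN1 mul1r. Qed.

HB.instance Definition _ :=
  Num.Zmodule_isSemiNormed.Build R V normD_le normMn_sqrt normN_sqrt.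

Lemma sqr_norm u : `|u| ^+ 2 = '[u, u]. Proof. exact: sqr_normE. Qed.

Lemma normZ c u : `|c *: u| = `|c| * `|u|. Proof. exact: normZ_sqrt. Qed.

Lemma dot_le_norm u v : '[u, v] <= `|u| * `|v|. Proof. exact: dot_le_normM. Qed.

Lemma cauchy_schwarz u v : `|'[u, v]| <= `|u| * `|v|.
Proof.
by rewrite ler_norml dot_le_norm andbT lerNl -dotNl -(normrN u) dot_le_norm.
Qed.

Lemma sqr_normD u v : `|u + v| ^+ 2 = `|u| ^+ 2 + 2 * '[u, v] + `|v| ^+ 2.
Proof. by rewrite !sqr_norm dotDl !dotDr (dotC v u); ring. Qed.

Lemma sqr_normB u v : `|u - v| ^+ 2 = '[u, u] - 2 * '[u, v] + '[v, v].
Proof. by rewrite sqr_norm dotBl !dotBr (dotC v u); ring. Qed.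

Lemma dot_eq0 u v : `|u| = 0 -> '[u, v] = 0.
Proof.
move=> u0; have := cauchy_schwarz u v; rewrite u0 mul0r => uv.
by apply/eqP; rewrite -normr_eq0 eq_le uv normr_ge0.
Qed.

End semi_inner_theory.

(** * Subgradients of a support function *)

Lemma perturbation_ge0 (R : realFieldType) (A B d : R) : 0 < d ->
  (forall s, 0 < s -> s <= d -> 0 <= s * A + s ^+ 2 * B) -> 0 <= A.
Proof.
move=> d0 quad_ge0; rewrite leNgt; apply/negP => A0.
have B1 : 0 < `|B| + 1 by rewrite ltr_wpDl.
pose s := Num.min d (- A / (2 * (`|B| + 1))).
have s0 : 0 < s by rewrite lt_min d0 divr_gt0 ?oppr_gt0// mulr_gt0.
have sd : s <= d by rewrite ge_min lexx.
have sB : s * (2 * (`|B| + 1)) <= - A.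
  by rewrite -ler_pdivlMr ?mulr_gt0// ge_min lexx orbT.
have := quad_ge0 s s0 sd; rewrite expr2 -mulrA -mulrDr pmulr_rge0// => AsB.
have : s * B <= s * `|B| by rewrite ler_pM2l// ler_norm.
lra.
Qed.

Lemma ler_linear_error (R : realFieldType) (A B C : R) :
  (forall r, 0 < r -> r <= 1 -> A <= B + r * C) -> A <= B.
Proof.
move=> AB; rewrite -subr_ge0; apply: (@perturbation_ge0 _ _ C 1) => // r r0 r1.
by have := AB r r0 r1; nra.
Qed.

Section subgradients.
Variables (R : rcfType) (V : semiInnerType R).
Implicit Types (A K : set V) (u v w x y z p q k : V) (c d lam r t T : R).

Definition adherent A u := forall r, 0 < r -> exists2 a, A a & `|u - a| <= r.

Lemma adherent_trans A K u : A `<=` adherent K -> adherent A u -> adherent K u.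
Proof.
move=> AK Au r r0; have r20 : 0 < r / 2 by rewrite divr_gt0.
have [a Aa ua] := Au _ r20; have [k Kk ak] := AK a Aa _ r20.
by exists k => //; rewrite (le_trans (ler_distD a u k))// (splitr r) lerD.
Qed.

Definition support_le K u c := forall k, K k -> '[u, k] <= c.

Lemma support_leD K u v c d :
  support_le K u c -> support_le K v d -> support_le K (u + v) (c + d).
Proof. by move=> uc vd k Kk; rewrite dotDl lerD ?uc ?vd. Qed.

Lemma support_leZ K u c t : 0 <= t ->
  support_le K u c -> support_le K (t *: u) (t * c).
Proof. by move=> t0 uc k Kk; rewrite dotZl ler_wpM2l ?uc. Qed.

Lemma support_le0 K : support_le K 0 0.
Proof. by move=> k _; rewrite dot0l. Qed.

Definition below_support K p := forall w c, support_le K w c -> '[p, w] <= c.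

(* By Hahn-Banach, [below_support K] is the closed convex hull of [K]; the
   support function is a supremum over it, attained at the subgradients. *)
Definition subgradient K p u := below_support K p /\ support_le K u '[p, u].

Lemma adherent_below_support K p : adherent K p -> below_support K p.
Proof.
move=> Kp w c wc; apply: (@ler_linear_error _ _ _ `|w|) => r r0 _.
have [k Kk pk] := Kp r r0.
rewrite -(subrK k p) dotDl addrC lerD//; first by rewrite dotC wc.
by rewrite (le_trans (dot_le_norm _ _))// ler_wpM2r.
Qed.

Lemma subgradient_closed K p u :
  (forall r, 0 < r -> exists q v,
    [/\ subgradient K q v, `|p - q| <= r & `|u - v| <= r]) ->
  subgradient K p u.
Proof.
move=> close; split=> [w c wc|k Kk].
  apply: (@ler_linear_error _ _ _ `|w|) => r r0 _.
  have [q [v [[bq _] pq _]]] := close r r0.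
  rewrite -(subrK q p) dotDl addrC lerD ?bq//.
  by rewrite (le_trans (dot_le_norm _ _))// ler_wpM2r.
apply: (@ler_linear_error _ _ _ (`|k| + `|u| + `|p| + 1)) => r r0 r1.
have [q [v [[_ sv] pq uv]]] := close r r0.
have uvk : '[u - v, k] <= r * `|k|.
  by rewrite (le_trans (dot_le_norm _ _))// ler_wpM2r.
have pqu : '[q - p, u] <= r * `|u|.
  by rewrite (le_trans (dot_le_norm _ _))// distrC ler_wpM2r.
have puv : '[p, v - u] <= `|p| * r.
  by rewrite (le_trans (dot_le_norm _ _))// distrC ler_wpM2l.
have qpvu : '[q - p, v - u] <= r * r.
  rewrite (le_trans (dot_le_norm _ _))// !(distrC _ p) (distrC v) ler_pM//.
have r_sqr_le : r * r <= r by rewrite ler_piMr// ltW.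
have := sv k Kk; move: uvk pqu puv qpvu.
by rewrite !dotBl !dotBr; lra.
Qed.

Lemma subgradient_monotone K p u q v :
  subgradient K p u -> subgradient K q v -> 0 <= '[p - q, u - v].
Proof.
move=> [bp su] [bq sv]; have := bp _ _ sv; have := bq _ _ su.
by rewrite dotBl !dotBr; lra.
Qed.

Lemma resolvent_firmly_nonexpansive K t p u q v : 0 <= t ->
  subgradient K p u -> subgradient K q v ->
  `|u - v| ^+ 2 + (t * `|p - q|) ^+ 2 <= `|(u + t *: p) - (v + t *: q)| ^+ 2.
Proof.
move=> t0 pu qv; rewrite opprD addrACA -scalerBr [leRHS]sqr_normD dotZr normZ.
rewrite ger0_norm//; have := mulr_ge0 t0 (subgradient_monotone pu qv).
by rewrite (dotC (u - v)); lra.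
Qed.

Lemma resolvent_nonexpansive K t p u q v : 0 <= t ->
  subgradient K p u -> subgradient K q v ->
  `|u - v| <= `|(u + t *: p) - (v + t *: q)|.
Proof.
move=> t0 pu qv; rewrite -(@ler_pXn2r _ 2) ?nnegrE//.
apply: le_trans (resolvent_firmly_nonexpansive t0 pu qv).
by rewrite lerDl sqr_ge0.
Qed.

Lemma yosida_nonexpansive K t p u q v : 0 <= t ->
  subgradient K p u -> subgradient K q v ->
  t * `|p - q| <= `|(u + t *: p) - (v + t *: q)|.
Proof.
move=> t0 pu qv; rewrite -(@ler_pXn2r _ 2) ?nnegrE ?mulr_ge0//.
apply: le_trans (resolvent_firmly_nonexpansive t0 pu qv).
by rewrite lerDr sqr_ge0.
Qed.

Lemma minimizer_subgradient K lam y z x T : 0 < lam -> support_le K (x - z) T ->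
  (forall w c, support_le K (w - z) c ->
    lam / 2 * `|x - y| ^+ 2 + T <= lam / 2 * `|w - y| ^+ 2 + c) ->
  subgradient K (lam *: (y - x)) (x - z).
Proof.
move=> lam0 xT xmin.
have perturbed w s : lam / 2 * `|x + s *: w - y| ^+ 2 = lam / 2 * `|x - y| ^+ 2
    - s * '[lam *: (y - x), w] + s ^+ 2 * (lam / 2 * `|w| ^+ 2).
  rewrite (addrAC x) [in LHS]sqr_normD normZ exprMn real_normK ?num_real//.
  by rewrite dotZr -opprB dotNl dotZl; lra.
split=> [w c wc|].
  rewrite -subr_ge0.
  apply: (@perturbation_ge0 _ _ (lam / 2 * `|w| ^+ 2) 1) => // s s0 _.
  have := xmin (x + s *: w) (T + s * c).
  rewrite perturbed (addrAC x).
  by move=> /(_ (support_leD xT (support_leZ (ltW s0) wc))); lra.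
suff TE : T <= '[lam *: (y - x), x - z] by move=> k /xT /le_trans; apply.
rewrite -subr_ge0.
apply: (@perturbation_ge0 _ _ (lam / 2 * `|x - z| ^+ 2) 1) => // s s0 s1.
have := xmin (x + (- s) *: (x - z)) ((1 - s) * T).
rewrite perturbed (addrAC x) -{1}(scale1r (x - z)) -scalerDl sqrrN.
have s_le1 : 0 <= 1 - s by rewrite subr_ge0.
by move=> /(_ (support_leZ s_le1 xT)); lra.
Qed.

Lemma optimality_unique K lam y z x z' x' : 0 < lam -> `|z - z'| = 0 ->
  subgradient K (lam *: (y - x)) (x - z) ->
  subgradient K (lam *: (y - x')) (x' - z') -> `|x - x'| = 0.
Proof.
move=> lam0 zz' opt opt'; have := subgradient_monotone opt opt'.
rewrite -scalerBr (_ : y - x - (y - x') = - (x - x')); last first.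
  by rewrite opprB addrC addrA subrK opprB.
rewrite (_ : x - z - (x' - z') = x - x' - (z - z')); last first.
  by rewrite opprD addrACA -opprD.
rewrite dotZl dotNl dotBr (dotC (x - x') (z - z')) (dot_eq0 _ zz') subr0.
rewrite -sqr_norm pmulr_rge0// oppr_ge0 => xx'0.
by apply/eqP; rewrite -sqrf_eq0 eq_le xx'0 sqr_ge0.
Qed.

End subgradients.

(** * The discrete taut string *)

Section taut_string.
Variable R : realFieldType.
Implicit Types (y F W : nat -> R) (a f d M : R) (i j k n : nat).

Definition residual a y F i : R := y i - a * (F i.+1 - F i).

(* [- f] is a subgradient of the absolute value at [d], when [`|f| <= 1]. *)
Definition opposed f d := (f < 1 -> 0 <= d) /\ (-1 < f -> d <= 0).

Definition taut n a y F : Prop :=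
  [/\ F 0%N = 0, F n = 0, forall i, `|F i| <= 1 &
   forall i, (i.+1 < n)%N ->
     opposed (F i.+1) (residual a y F i.+1 - residual a y F i)].

Lemma opposed_norm f d : `|f| <= 1 -> opposed f d -> `|d| = - (f * d).
Proof.
rewrite ler_norml => /andP[f_geN1 f_le1] [d_ge0 d_le0].
have [f1|f1] := eqVneq f 1.
  by rewrite f1 mul1r ler0_norm// d_le0// f1; lra.
have [fN1|fN1] := eqVneq f (-1).
  by rewrite fN1 mulN1r opprK ger0_norm// d_ge0// fN1; lra.
suff -> : d = 0 by rewrite normr0 mulr0 oppr0.
apply/eqP; rewrite eq_le d_le0 ?d_ge0// lt_neqAle ?f1//.
by rewrite eq_sym fN1.
Qed.

Lemma opposedN f d : opposed f d -> opposed (- f) (- d).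
Proof.
move=> [d_ge0 d_le0]; split=> f_bound; rewrite ?oppr_ge0 ?oppr_le0.
  by apply: d_le0; lra.
by apply: d_ge0; lra.
Qed.

Lemma tautN n a y F : taut n a y F -> taut n a (- y) (- F).
Proof.
move=> [F0 Fn F1 Fx].
split=> [||i|i ilt]; rewrite ?opprfctE /= ?F0 ?Fn ?oppr0 ?normrN//.
rewrite (_ : _ - _ = - (residual a y F i.+1 - residual a y F i)).
  exact/opposedN/Fx.
by rewrite /residual; ring.
Qed.

Lemma convex_above_le n M W : W 0%N <= M -> W n <= M ->
  (forall k, (k.+1 < n)%N -> M < W k.+1 -> 2 * W k.+1 <= W k + W k.+2) ->
  forall i, (i <= n)%N -> W i <= M.
Proof.
move=> W0 Wn Wconvex; elim=> [//|i IHi ilen]; rewrite leNgt; apply/negP => WiM.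
have grows j : (i + j < n)%N -> M < W (i + j).+1 /\ W (i + j)%N < W (i + j).+1.
  elim: j => [|j IHj] ijn; first by rewrite addn0; have := IHi (ltnW ilen); lra.
  rewrite addnS in ijn *; have [WM Wlt] := IHj (ltnW ijn).
  by have := Wconvex (i + j)%N ijn WM; lra.
have n_pred : (i + (n.-1 - i)).+1 = n by lia.
have [|] := grows (n.-1 - i)%N; first by lia.
by rewrite n_pred ltNge Wn.
Qed.

(* Where the bound fails, [F1] is off the lower side of the tube and [F2] off
   the upper one, so that the difference is convex there. *)
Lemma taut_diff_le n a1 a2 y F1 F2 i : 0 < a2 -> a2 <= a1 ->
  taut n a1 y F1 -> taut n a2 y F2 -> (i <= n)%N ->
  a1 * F1 i - a2 * F2 i <= a1 - a2.
Proof.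
move=> a20 a21 [F10 F1n F1b F1x] [F20 F2n F2b F2x].
move: i; apply: convex_above_le => [||k kn].
- by rewrite F10 F20 !mulr0 subr0 subr_ge0.
- by rewrite F1n F2n !mulr0 subr0 subr_ge0.
have [_ x1_le] := F1x k kn; have [x2_ge _] := F2x k kn.
move: (F1b k.+1) (F2b k.+1); rewrite !ler_norml => /andP[? ?] /andP[? ?] W_gt.
have F1_gt : -1 < F1 k.+1 by nra.
have F2_lt : F2 k.+1 < 1 by nra.
by have := x1_le F1_gt; have := x2_ge F2_lt; rewrite /residual; lra.
Qed.

Lemma taut_diff_ge n a1 a2 y F1 F2 i : 0 < a2 -> a2 <= a1 ->
  taut n a1 y F1 -> taut n a2 y F2 -> (i <= n)%N ->
  a2 - a1 <= a1 * F1 i - a2 * F2 i.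
Proof.
move=> a20 a21 /tautN t1 /tautN t2 ilen.
by have := taut_diff_le a20 a21 t1 t2 ilen; rewrite !opprfctE; lra.
Qed.

Lemma taut_increment_le n a1 a2 y F1 F2 i : 0 < a2 -> a2 <= a1 ->
  taut n a1 y F1 -> taut n a2 y F2 -> (i.+1 < n)%N -> F2 i.+1 < 1 ->
  residual a1 y F1 i.+1 - residual a1 y F1 i <=
  residual a2 y F2 i.+1 - residual a2 y F2 i.
Proof.
move=> a20 a21 t1 t2 ilt F2_lt.
have W_ge j := @taut_diff_ge _ _ _ _ _ _ j a20 a21 t1 t2.
case: (t1) (t2) => _ _ F1b F1x [_ _ F2b F2x].
move: (F1b i.+1) (F2b i.+1); rewrite !ler_norml => /andP[? ?] /andP[? ?].
have [_ x1_le] := F1x i ilt; have [/(_ F2_lt) x2_ge _] := F2x i ilt.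
have [F1N1|F1N1] := eqVneq (F1 i.+1) (-1).
  have := W_ge i.+2 ilt; have := W_ge i (ltnW (ltnW ilt)).
  by rewrite /residual F1N1; nra.
have F1_gt : -1 < F1 i.+1 by rewrite lt_neqAle eq_sym F1N1.
by have := x1_le F1_gt; lra.
Qed.

Lemma taut_diff_opposed n a1 a2 y F1 F2 i : 0 < a2 -> a2 <= a1 ->
  taut n a1 y F1 -> taut n a2 y F2 -> (i.+1 < n)%N ->
  let x := residual a2 y F2 \- residual a1 y F1 in
  opposed (F2 i.+1) (x i.+1 - x i).
Proof.
move=> a20 a21 t1 t2 ilt /=; split=> [F2_lt|F2_gt].
  by have := taut_increment_le a20 a21 t1 t2 ilt F2_lt; lra.
have := taut_increment_le a20 a21 (tautN t1) (tautN t2) ilt.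
by rewrite /residual !opprfctE ltrNl => /(_ F2_gt); lra.
Qed.

End taut_string.

Section taut_string_existence.
Variable R : realType.
Implicit Types (y F : nat -> R) (a s : R) (i n : nat).

Definition box n : set {ptws nat -> R^o} := [set F |
  forall i, (if (0 < i < n)%N then `[-1, 1]%classic else [set 0]) (F i)].

Definition energy n a y F : R := \sum_(i < n) residual a y F i ^+ 2.

Lemma compact_box n : compact (box n).
Proof.
apply: (@tychonoff _ (fun=> R^o)
  (fun i => if (0 < i < n)%N then `[-1, 1]%classic else [set 0])) => i.
by case: ifP => _; [exact: segment_compact|exact: compact_set1].
Qed.

Lemma continuous_energy n a y :
  continuous (energy n a y : {ptws nat -> R^o} -> R^o).
Proof.
have cproj i : continuous (fun F : {ptws nat -> R^o} => F i : R^o).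
  exact: (@proj_continuous nat (fun=> R^o) i).
apply: continuous_big => [|i _ F]; first exact: add_continuous.
pose residual_i (G : {ptws nat -> R^o}) : R^o := residual a y G i.
apply: (@continuous_comp _ _ _ residual_i (@GRing.exp R ^~ 2%N) F); last first.
  exact: exprn_continuous.
apply: continuousB; first exact: cst_continuous.
apply: continuousM; first exact: cst_continuous.
by apply: continuousB; exact: cproj.
Qed.

Lemma energy_minimizer n a y :
  exists2 F, box n F & forall G, box n G -> energy n a y F <= energy n a y G.
Proof.
have box0 : box n !=set0.
  exists (fun=> 0) => i; case: ifP => //= _.
  by rewrite in_itv/= lerN10 ler01.
have [F /set_mem boxF Fmin] := compact_EVT_min box0 (@compact_box n)
  (continuous_subspaceT (@continuous_energy n a y)).
by exists F => // G boxG; apply: Fmin; exact: mem_set.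
Qed.

Lemma energy_bump n a y F i s : (i.+1 < n)%N ->
  let G j := F j + s * (j == i.+1)%:R in
  energy n a y G - energy n a y F =
    s * (2 * a * (residual a y F i.+1 - residual a y F i)) +
    s ^+ 2 * (2 * a ^+ 2).
Proof.
move=> ilt G; rewrite /energy -sumrB.
have i1 : (i < n)%N by exact: ltnW.
rewrite (bigD1 (Ordinal i1))//= (bigD1 (Ordinal ilt))/=; last first.
  by rewrite -(inj_eq val_inj)/= eqn_leq ltnn.
rewrite big1 => [|j /andP[]]; last first.
  rewrite -!(inj_eq val_inj)/= => ji ji1.
  by rewrite /residual /G eqSS (negPf ji) (negPf ji1) !mulr0 !addr0 subrr.
rewrite /residual /G !eqSS eqxx (ltn_eqF (ltnSn i)) (gtn_eqF (ltnSn i)) /=.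
by ring.
Qed.

Lemma boxP n F : box n F ->
  [/\ forall i, ~~ (0 < i < n)%N -> F i = 0 & forall i, `|F i| <= 1].
Proof.
move=> boxF; split=> i; have := boxF i; first by move=> /[swap] /negPf ->.
by case: ifP => _ /=; [rewrite in_itv/= ler_norml|move=> ->; rewrite normr0].
Qed.

Lemma box_bump n F i s : box n F -> (i.+1 < n)%N -> -1 <= F i.+1 + s <= 1 ->
  box n (fun j => F j + s * (j == i.+1)%:R).
Proof.
move=> boxF ilt s1 j; have := boxF j.
have [->|_] := eqVneq j i.+1; first by rewrite ilt/= mulr1 in_itv.
by rewrite mulr0 addr0.
Qed.

(* Taut strings solve the dual problem of minimizing the residual in the box. *)
Lemma taut_exists n a y : 0 < a -> exists F, taut n a y F.
Proof.
move=> a0; have [F boxF Fmin] := energy_minimizer n a y.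
have [F0 F1] := boxP boxF.
exists F; split=> [||//|i ilt]; [exact: F0|by rewrite F0// ltnn andbF|].
set d := residual a y F i.+1 - residual a y F i.
have bump_ge0 s : -1 <= F i.+1 + s <= 1 ->
    0 <= s * (2 * a * d) + s ^+ 2 * (2 * a ^+ 2).
  move=> s1; rewrite -(energy_bump a y F s ilt) subr_ge0 Fmin//.
  exact: box_bump.
have := F1 i.+1; rewrite ler_norml => /andP[F_ge F_le].
have a20 : 0 < 2 * a by rewrite mulr_gt0.
split=> Fi.
  rewrite -(pmulr_rge0 _ a20).
  apply: (@perturbation_ge0 _ _ (2 * a ^+ 2) (1 - F i.+1)) => [|s s0 sF].
    by rewrite subr_gt0.
  by apply: bump_ge0; lra.
rewrite -oppr_ge0 -(pmulr_rge0 _ a20).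
apply: (@perturbation_ge0 _ _ (2 * a ^+ 2) (1 + F i.+1)) => [|s s0 sF].
  by lra.
have := bump_ge0 (- s); rewrite sqrrN mulNr -!mulrN; apply; lra.
Qed.

End taut_string_existence.

(** * Smooth steps *)

Section smooth_functions.
Variable R : realType.
Implicit Types (f g F S : R -> R) (p q : {poly R}) (a b c d e r t s : R).

Definition smooth f := forall n t, derivable (derive1n n f) t 1.

Lemma is_derive_derive1E f g :
  (forall t, is_derive t 1 f (g t)) -> derive1 f = g.
Proof. by move=> fg; apply/funext => t; rewrite derive1E derive_val. Qed.

Lemma is_derive_continuous f g :
  (forall t, is_derive t 1 f (g t)) -> continuous f.
Proof.
by move=> fg t; apply/differentiable_continuous/derivable1_diffP; case: (fg t).
Qed.

Lemma smooth_coind (P : (R -> R) -> Prop) :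
  (forall f, P f -> exists2 g, forall t, is_derive t 1 f (g t) & P g) ->
  forall f, P f -> smooth f.
Proof.
move=> Pderive f Pf n; have : P (derive1n n f).
  elim: n => //= n /Pderive[g fg Pg].
  by rewrite (is_derive_derive1E fg).
by move=> /Pderive[g fg _] t; case: (fg t).
Qed.

Lemma smooth_is_derive f : smooth f -> forall t, is_derive t 1 f (derive1 f t).
Proof.
by move=> sf t; apply: DeriveDef; [exact: (sf 0%N)|rewrite derive1E].
Qed.

Lemma smooth_continuous f : smooth f -> continuous f.
Proof. by move=> /smooth_is_derive/is_derive_continuous. Qed.

Lemma smooth_derive1 f : smooth f -> smooth (derive1 f).
Proof. by move=> sf n t; have := sf n.+1 t; rewrite /derive1n iterSr. Qed.

Lemma is_derive_smooth f g : (forall t, is_derive t 1 f (g t)) -> smooth g ->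
  smooth f.
Proof.
move=> fg sg [|n] t; first by case: (fg t).
by rewrite /derive1n iterSr (is_derive_derive1E fg); exact: sg.
Qed.

Lemma smooth_cst c : smooth (fun=> c).
Proof.
apply: (@smooth_coind (fun f => exists c, f = fun=> c)); last by exists c.
move=> _ [d ->]; exists (fun=> 0); last by exists 0.
by move=> t; exact: is_derive_cst.
Qed.

Lemma is_derive_affine f a b d t : is_derive (a * t + b) 1 f d ->
  is_derive t 1 (fun t => f (a * t + b)) (a * d).
Proof.
move=> fd.
have dg : is_derive t 1 (fun t => a * t + b) a.
  by apply: is_derive_eq; rewrite /GRing.scale /=; ring.
by rewrite mulrC; exact: (@is_derive1_comp _ f (fun t => a * t + b)).
Qed.

(* Closed under derivation, unlike the products of two smooth functions. *)
Inductive smooth_algebra : (R -> R) -> Prop :=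
| smooth_algebra_smooth f of smooth f : smooth_algebra f
| smooth_algebraD f g of smooth_algebra f & smooth_algebra g :
    smooth_algebra (fun t => f t + g t)
| smooth_algebraM f g of smooth_algebra f & smooth_algebra g :
    smooth_algebra (fun t => f t * g t)
| smooth_algebra_affine f a b of smooth_algebra f :
    smooth_algebra (fun t => f (a * t + b)).

Lemma smooth_algebra_derive f : smooth_algebra f ->
  exists2 g, forall t, is_derive t 1 f (g t) & smooth_algebra g.
Proof.
elim=> {f} [f sf|f g af [f' df af'] ag [g' dg ag']
  |f g af [f' df af'] ag [g' dg ag']|f a b _ [f' df af']].
- exists (derive1 f); first exact: smooth_is_derive.
  exact/smooth_algebra_smooth/smooth_derive1.
- exists (fun t => f' t + g' t); last exact: smooth_algebraD.
  by move=> t; have dft := df t; have dgt := dg t; exact: is_deriveD.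
- exists (fun t => f t * g' t + g t * f' t).
    by move=> t; have dft := df t; have dgt := dg t; exact: is_deriveM.
  by apply: smooth_algebraD; apply: smooth_algebraM.
- exists (fun t => a * f' (a * t + b)).
    by move=> t; apply: is_derive_affine; exact: df.
  apply: (@smooth_algebraM (fun=> a)); last exact: smooth_algebra_affine.
  exact/smooth_algebra_smooth/smooth_cst.
Qed.

Lemma smooth_of_algebra f : smooth_algebra f -> smooth f.
Proof. exact: smooth_coind smooth_algebra_derive f. Qed.

Lemma smoothD f g : smooth f -> smooth g -> smooth (fun t => f t + g t).
Proof.
move=> sf sg; apply/smooth_of_algebra/smooth_algebraD.
  exact: smooth_algebra_smooth.
exact: smooth_algebra_smooth.
Qed.

Lemma smoothM f g : smooth f -> smooth g -> smooth (fun t => f t * g t).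
Proof.
move=> sf sg; apply/smooth_of_algebra/smooth_algebraM.
  exact: smooth_algebra_smooth.
exact: smooth_algebra_smooth.
Qed.

Lemma smooth_affine f a b : smooth f -> smooth (fun t => f (a * t + b)).
Proof.
move=> sf; apply/smooth_of_algebra/smooth_algebra_affine.
exact: smooth_algebra_smooth.
Qed.

Lemma smooth_sum n (F : nat -> R -> R) : (forall i, smooth (F i)) ->
  smooth (fun t => \sum_(i < n) F i t).
Proof.
move=> sF; elim: n => [|n IH].
  by under eq_fun do rewrite big_ord0; exact: smooth_cst.
under eq_fun do rewrite big_ord_recr /=.
by apply: smoothD; [exact: IH|exact: sF].
Qed.

Lemma increment_mean_value f g a b :
  (forall t, is_derive t 1 f (g t)) -> a <= b ->
  exists2 c, a <= c <= b & f b - f a = g c * (b - a).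
Proof.
move=> fg ab.
have [|c] := MVT_segment ab (fun x _ => fg x); last by rewrite in_itv; exists c.
exact/continuous_subspaceT/(is_derive_continuous fg).
Qed.

Lemma derive_ge0_le f g a b : (forall t, is_derive t 1 f (g t)) ->
  (forall t, 0 <= g t) -> a <= b -> f a <= f b.
Proof.
move=> fg g0 ab; have [c _ fE] := increment_mean_value fg ab.
by rewrite -subr_ge0 fE mulr_ge0// subr_ge0.
Qed.

Lemma antiderivative f a : continuous f -> (forall t, t <= a -> f t = 0) ->
  exists2 F, forall t, is_derive t 1 F (f t) & forall t, t <= a -> F t = 0.
Proof.
move=> cf f0.
pose F x := \int[lebesgue_measure]_(t in `[a - 1, x]) f t.
have F0 t : t <= a -> F t = 0.
  move=> ta; rewrite /F (@eq_Rintegral _ _ _ _ _ (fun=> 0)).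
    by rewrite /Rintegral integral0.
  move=> s; rewrite inE /= in_itv /= => /andP[_ st].
  by rewrite f0// (le_trans st).
exists F => // t; have [ta|ta] := ltP (a - 1) t.
  have [||dF F'] := @continuous_FTC1_closed R f (a - 1) t (t + 1) _ _ ta (cf t).
  - by rewrite ltrDl.
  - apply: continuous_compact_integrable; first exact: segment_compact.
    exact: continuous_subspaceT.
  by apply: DeriveDef; [exact: dF|rewrite -derive1E].
have {}ta : t < a by rewrite (le_lt_trans ta)// gtrBl.
rewrite f0 ?(ltW ta)//; apply: (@near_eq_is_derive R R R (fun=> 0)).
by near=> s; rewrite F0//; apply: ltW; near: s; exact: lt_nbhsl.
Unshelve. all: by end_near. Qed.

Lemma expn_expN_bounded n s : 0 <= s -> s ^+ n * expR (- s) <= n`!%:R.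
Proof.
move=> s0; case: n => [|n].
  by rewrite expr0 mul1r -expR0 ler_expR oppr_le0.
rewrite expRN ler_pdivrMr ?expR_gt0// mulrC -ler_pdivrMr ?ltr0n ?fact_gt0//.
by apply: le_trans (expR_ge1Dxn n s0); rewrite lerDr.
Qed.

Lemma poly_expN_bounded p :
  exists c, forall s, 0 <= s -> `|p.[s] * expR (- s)| <= c.
Proof.
exists (\sum_(i < size p) `|p`_i| * i`!%:R) => s s0.
rewrite horner_coef mulr_suml (le_trans (ler_norm_sum _ _ _))//.
rewrite ler_sum// => i _; rewrite -mulrA normrM ler_wpM2l// ger0_norm.
  exact: expn_expN_bounded.
by rewrite mulr_ge0 ?expR_ge0 ?exprn_ge0.
Qed.

Definition flat p t : R := if 0 < t then p.[t^-1] * expR (- t^-1) else 0.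

Lemma flat_quadratic p : exists c, forall t, `|flat p t| <= c * t ^+ 2.
Proof.
have [c pX2_le] := poly_expN_bounded (p * 'X^2).
have c0 : 0 <= c by apply: le_trans (pX2_le 0 _).
exists c => t; rewrite /flat; case: ifPn => [t0|_]; last first.
  by rewrite normr0 mulr_ge0 ?sqr_ge0.
have := pX2_le t^-1; rewrite invr_ge0 (ltW t0) => /(_ isT).
rewrite hornerM hornerXn -mulrA (mulrC (_ ^+ 2)) mulrA normrM.
rewrite [X in _ * X]ger0_norm ?sqr_ge0// exprVn ler_pdivrMr//.
by rewrite exprn_gt0.
Qed.

Lemma is_derive0_quadratic f c : (forall t, `|f t| <= c * t ^+ 2) ->
  is_derive (0 : R) 1 f 0.
Proof.
move=> f_le.
have c0 : 0 <= c by have := f_le 1; rewrite expr1n mulr1; exact: le_trans.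
have f0 : f 0 = 0.
  by apply/eqP; rewrite -normr_le0 (le_trans (f_le 0))// expr0n mulr0.
have cvg0 : (fun h : R => h^-1 *: ((f \o shift 0) (h *: (1:R)) - f 0))
    @ 0^' --> (0 : R).
  apply/cvgr0Pnorm_le => e e0.
  near=> h; rewrite /= addr0 /GRing.scale /= mulr1 f0 subr0 normrM normfV.
  have h0 : 0 < `|h| by rewrite normr_gt0; near: h; exact: nbhs_dnbhs_neq.
  rewrite mulrC ler_pdivrMr// (le_trans (f_le h))//.
  rewrite -[h ^+ 2]real_normK ?num_real// expr2 mulrA ler_wpM2r//.
  have : `|h| < e / (c + 1).
    by near: h; apply: dnbhs0_lt; rewrite divr_gt0// ltr_wpDl.
  rewrite ltr_pdivlMr ?ltr_wpDl// => hlt.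
  by apply: le_trans (ltW hlt); rewrite mulrC ler_wpM2l// lerDl.
by apply: DeriveDef; [apply/cvg_ex; exists 0|exact/cvg_lim].
Unshelve. all: by end_near. Qed.

Lemma is_derive_flat_gt0 p t : 0 < t ->
  is_derive t 1 (flat p) (flat ('X^2 * (p - p^`())) t).
Proof.
move=> t0; rewrite [flat _ t]/flat t0.
apply: (@near_eq_is_derive R R R (fun t => p.[t^-1] * expR (- t^-1))).
  by near=> s; rewrite /flat (_ : 0 < s)//; near: s; exact: lt_nbhsr.
have tn0 : t != 0 by rewrite gt_eqF.
have dV : is_derive t 1 (fun t : R => t^-1) (- t ^- 2).
  apply: DeriveDef; first exact: derivableV.
  by rewrite deriveV// derive_id /GRing.scale /= mulr1.
have dp : is_derive t 1 (fun t => p.[t^-1]) (p^`().[t^-1] * - t ^- 2).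
  exact: (@is_derive1_comp _ (horner p) (fun t => t^-1)).
have dNV : is_derive t 1 (fun t => - t^-1) (t ^- 2).
  by apply: is_derive_eq; rewrite opprK.
have dexp : is_derive t 1 (fun t => expR (- t^-1)) (expR (- t^-1) * t ^- 2).
  exact: (@is_derive1_comp _ expR (fun t => - t^-1)).
by apply: is_derive_eq; rewrite /GRing.scale /= !hornerE /= exprVn; ring.
Unshelve. all: by end_near. Qed.

Lemma is_derive_flat p t : is_derive t 1 (flat p) (flat ('X^2 * (p - p^`())) t).
Proof.
have [t0|t0|->] := ltgtP t 0; last 2 first.
- exact: is_derive_flat_gt0.
- rewrite [flat _ 0]/flat ltxx; have [c] := flat_quadratic p.
  exact: is_derive0_quadratic.
rewrite [flat _ t]/flat ltNge (ltW t0) /=.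
apply: (@near_eq_is_derive R R R (fun=> 0)).
near=> s; rewrite /flat ltNge (_ : s <= 0)//; apply: ltW.
by near: s; exact: lt_nbhsl.
Unshelve. all: by end_near. Qed.

Lemma smooth_flat p : smooth (flat p).
Proof.
apply: (@smooth_coind (fun f => exists p, f = flat p)); last by exists p.
move=> _ [q ->]; exists (flat ('X^2 * (q - q^`()))); last by eexists.
by move=> t; exact: is_derive_flat.
Qed.

Lemma flat1_itv t : 0 <= flat 1 t <= 1.
Proof.
rewrite /flat hornerC mul1r; case: ifP => [t0|_]; last by rewrite lexx ler01.
by rewrite expR_ge0 -expR0 ler_expR oppr_le0 invr_ge0 ltW.
Qed.

Lemma flat1_ge d t : 0 < d -> d^-1 <= t -> 1 - d <= flat 1 t.
Proof.
move=> d0 dt; have t0 : 0 < t by rewrite (lt_le_trans _ dt)// invr_gt0.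
rewrite /flat hornerC mul1r t0; apply: le_trans (expR_ge1Dx _).
by rewrite lerD2l lerN2 -[leRHS]invrK lef_pV2// ?posrE// invr_gt0.
Qed.

Lemma smooth_plateau d : 0 < d -> d < 1 / 2 -> exists f r, [/\ 0 < r, smooth f,
  forall t, 0 <= f t <= 1,
  forall t, (t <= r) || (1 - r <= t) -> f t = 0 &
  forall t, d <= t <= 1 - d -> (1 - d) ^+ 2 <= f t].
Proof.
move=> d0 d2; pose k := (d^-1 + 1) / d.
have kd : k * d = d^-1 + 1 by rewrite /k divfK// gt_eqF.
have k0 : 0 < k by rewrite divr_gt0// ltr_wpDr// invr_gt0.
have kV : k * k^-1 = 1 by rewrite divff// gt_eqF.
exists (fun t => flat 1 (k * t + -1) * flat 1 ((- k) * t + (k - 1))), k^-1.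
split.
- by rewrite invr_gt0.
- by apply: smoothM; apply: smooth_affine; exact: smooth_flat.
- move=> t; have /andP[? ?] := flat1_itv (k * t + -1).
  have /andP[? ?] := flat1_itv ((- k) * t + (k - 1)).
  by rewrite mulr_ge0// mulr_ile1.
- move=> t /orP[tk|tk]; rewrite /flat !ltNge.
    rewrite (_ : k * t + -1 <= 0) ?mul0r//.
    by have := ler_wpM2l (ltW k0) tk; rewrite kV; lra.
  rewrite (_ : - k * t + (k - 1) <= 0) ?mulr0//.
  by have := ler_wpM2l (ltW k0) tk; rewrite mulrBr kV; lra.
- move=> t /andP[dt td]; have d1 : 0 <= 1 - d by lra.
  rewrite expr2; apply: ler_pM => //; apply: flat1_ge => //.
    by have := ler_wpM2l (ltW k0) dt; rewrite kd; lra.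
  by have := ler_wpM2l (ltW k0) td; rewrite mulrBr kd; lra.
Qed.

Definition smooth_step e d S : Prop :=
  [/\ 0 < d, smooth S, forall t, t <= d -> S t = 0,
   forall t, 1 - d <= t -> S t = 1 & forall t, 0 <= derive1 S t <= 1 + e].

Lemma plateau_mass_ge f F d e :
  0 < d -> 4 * d <= 1 -> 1 <= (1 - 4 * d) * (1 + e) ->
  (forall t, is_derive t 1 F (f t)) -> (forall t, 0 <= f t) ->
  (forall t, d <= t <= 1 - d -> (1 - d) ^+ 2 <= f t) -> F 0 = 0 ->
  1 <= F 1 * (1 + e).
Proof.
move=> d0 d4 de dF f0 f_ge F0.
have dd : d <= 1 - d by lra.
have [c cd Fc] := increment_mean_value dF dd.
have Fd : 0 <= F d by rewrite -F0 (derive_ge0_le dF)// ltW.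
have F1d : F (1 - d) <= F 1 by apply: (derive_ge0_le dF) => //; lra.
have e1 : 0 <= 1 + e by nra.
apply: le_trans de _; rewrite ler_wpM2r//.
apply: (@le_trans _ _ ((1 - d) ^+ 2 * (1 - d - d))); first by nra.
apply: (@le_trans _ _ (F (1 - d) - F d)); last by lra.
by rewrite Fc ler_wpM2r ?f_ge//; lra.
Qed.

Lemma smooth_step_exists e : 0 < e -> exists S d, smooth_step e d S.
Proof.
move=> e0; have e1 : 0 < 1 + e by rewrite addr_gt0.
pose d := e / (8 * (1 + e)).
have d0 : 0 < d by rewrite divr_gt0// mulr_gt0.
have dE : d * (8 * (1 + e)) = e by rewrite divfK// mulf_neq0// ?gt_eqF.
have d2 : d < 1 / 2 by nra.
have [f [r [r0 sf f01 f_eq0 f_ge]]] := smooth_plateau d0 d2.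
have f0 t : 0 <= f t by case/andP: (f01 t).
have [F dF F0] := antiderivative (smooth_continuous sf)
  (fun t tr => f_eq0 t (introT orP (or_introl tr))).
have F00 : F 0 = 0 by rewrite F0// ltW.
have F1 : 1 <= F 1 * (1 + e).
  by apply: plateau_mass_ge dF f0 f_ge F00; nra.
have F1_gt0 : 0 < F 1 by rewrite -(pmulr_lgt0 _ e1) (lt_le_trans _ F1).
have dS t : is_derive t 1 (fun t => (F 1)^-1 * F t) ((F 1)^-1 * f t).
  by have dFt := dF t; exact: (is_deriveZ (F 1)^-1).
exists (fun t => (F 1)^-1 * F t), r; split => //.
- by apply: is_derive_smooth dS _; apply: smoothM => //; exact: smooth_cst.
- by move=> t /F0 ->; rewrite mulr0.
- move=> t rt; suff -> : F t = F 1 by rewrite mulVf// gt_eqF.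
  suff F_const a b : 1 - r <= a -> a <= b -> F b = F a.
    have [t1|/ltW t1] := leP t 1; first by rewrite (F_const t).
    by rewrite (F_const 1 t)//; lra.
  move=> ra ab; have [c /andP[ac _] Fc] := increment_mean_value dF ab.
  by apply/eqP; rewrite -subr_eq0 Fc f_eq0 ?mul0r// (le_trans ra ac) orbT.
- move=> t; rewrite (is_derive_derive1E dS) mulr_ge0 ?invr_ge0 ?(ltW F1_gt0)//=.
  rewrite ler_pdivrMl//; case/andP: (f01 t) => _ /le_trans; exact.
Qed.

End smooth_functions.

Section summation_by_parts.
Variable R : comNzRingType.
Implicit Types (F b : nat -> R) (m n : nat).

Lemma sum_increments F n : \sum_(i < n) (F i.+1 - F i) = F n - F 0%N.
Proof.
by rewrite -(big_mkord xpredT (fun i => F i.+1 - F i)) telescope_sumr.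
Qed.

Lemma sum_by_parts F b n : \sum_(i < n) (F i.+1 - F i) * b i =
  F n * b n - F 0%N * b 0%N - \sum_(i < n) F i.+1 * (b i.+1 - b i).
Proof.
elim: n => [|n IH]; first by rewrite !big_ord0; ring.
by rewrite !big_ord_recr /= IH; ring.
Qed.

Lemma sum_by_parts0 F b m : F 0%N = 0 -> F m.+1 = 0 ->
  \sum_(i < m.+1) (F i.+1 - F i) * b i =
  - \sum_(i < m) F i.+1 * (b i.+1 - b i).
Proof.
move=> F0 Fm; rewrite sum_by_parts F0 Fm big_ord_recr /= Fm.
by rewrite !mul0r subrr addr0 sub0r.
Qed.

End summation_by_parts.

Section interpolation.
Variable R : realType.
Implicit Types (F b : nat -> R) (S : R -> R) (e d t : R).

Lemma norm_sum_increments_le F b n : F 0%N = 0 -> (forall i, `|F i| <= 1) ->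
  (forall i, b i.+1 <= b i) -> 0 <= b n ->
  `|\sum_(i < n) (F i.+1 - F i) * b i| <= b 0%N.
Proof.
move=> F0 F1 b_decr bn; rewrite sum_by_parts F0 mul0r subr0.
have FM i c : 0 <= c -> `|F i * c| <= c.
  by move=> c0; rewrite normrM (ger0_norm c0) ler_piMl.
have -> : b 0%N = b n + \sum_(i < n) - (b i.+1 - b i).
  by rewrite sumrN sum_increments; ring.
apply: le_trans (ler_normB _ _) (lerD _ _); first exact: FM.
apply: le_trans (ler_norm_sum _ _ _) (ler_sum _ _) => i _.
by rewrite -normrN -mulrN FM// oppr_ge0 subr_le0.
Qed.

(* For a step [S], takes the value [F i] at [i / n], with slope close to
   constant in between. *)
Definition smooth_interp S F n t : R :=
  \sum_(i < n) (F i.+1 - F i) * S (n%:R * t - i%:R).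

Section smooth_interp_theory.
Variables (S : R -> R) (e d : R) (F : nat -> R) (n : nat).
Hypotheses (stepS : smooth_step e d S) (n_gt0 : (0 < n)%N).
Hypotheses (F0 : F 0%N = 0) (Fn : F n = 0) (F1 : forall i, `|F i| <= 1).

Lemma smooth_step_mono s t : s <= t -> S s <= S t.
Proof.
case: stepS => _ sS _ _ dS; apply: derive_ge0_le (smooth_is_derive sS) _.
by move=> r; case/andP: (dS r).
Qed.

Lemma smooth_step_itv t : 0 <= S t <= 1.
Proof.
case: stepS => _ _ S0 S1 _; apply/andP; split.
  rewrite -(S0 (Num.min t d)) ?ge_min ?lexx ?orbT//.
  by rewrite smooth_step_mono// ge_min lexx.
rewrite -(S1 (Num.max t (1 - d))) ?le_max ?lexx ?orbT//.
by rewrite smooth_step_mono// le_max lexx.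
Qed.

Lemma smooth_interp_smooth : smooth (smooth_interp S F n).
Proof.
case: stepS => _ sS _ _ _.
apply: (@smooth_sum _ _ (fun i t => (F i.+1 - F i) * S (n%:R * t - i%:R))) => i.
by apply: smoothM; [exact: smooth_cst|exact: smooth_affine].
Qed.

Lemma smooth_interp_le1 t : `|smooth_interp S F n t| <= 1.
Proof.
apply: le_trans
  (norm_sum_increments_le (b := fun i => S (n%:R * t - i%:R)) _ _ _ _) _ => //.
- by move=> i; apply: smooth_step_mono; rewrite lerD2l lerN2 ler_nat.
- by case/andP: (smooth_step_itv (n%:R * t - n%:R)).
- by case/andP: (smooth_step_itv (n%:R * t - 0%:R)).
Qed.

Lemma derive1_smooth_interp t : derive1 (smooth_interp S F n) t =
  \sum_(i < n) n%:R * (F i.+1 - F i) * derive1 S (n%:R * t - i%:R).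
Proof.
case: stepS => _ sS _ _ _; rewrite derive1E; apply: derive_val.
pose g (i : 'I_n) t := (F i.+1 - F i) * S (n%:R * t - i%:R).
have dg (i : 'I_n) : is_derive t 1 (g i)
    (n%:R * (F i.+1 - F i) * derive1 S (n%:R * t - i%:R)).
  rewrite mulrAC mulrC; apply: (is_deriveZ (F i.+1 - F i)).
  exact/is_derive_affine/smooth_is_derive.
have := @is_derive_sum R R R n g t 1 _ dg.
rewrite [X in is_derive _ _ X _](_ : _ = fun t => \sum_(i < n) g i t)//.
by apply/funext => s; rewrite fct_sumE.
Qed.

Lemma smooth_interp_supp t :
  smooth_interp S F n t != 0 -> d / n%:R <= t <= 1 - d / n%:R.
Proof.
case: stepS => d0 _ S0 S1 _; have nR0 : 0 < n%:R :> R by rewrite ltr0n.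
rewrite ler_pdivrMr// [_ <= 1 - _]lerBrDr -lerBrDl ler_pdivrMr// mulrBl mul1r.
rewrite !(mulrC t); apply: contraR; rewrite negb_and -!ltNge => /orP[tn|tn].
  rewrite /smooth_interp big1// => i _; rewrite S0 ?mulr0//.
  by rewrite (le_trans _ (ltW tn))// gerBl.
have <- : \sum_(i < n) (F i.+1 - F i) = 0 by rewrite sum_increments F0 Fn subrr.
apply/eqP; apply: eq_bigr => i _; rewrite S1 ?mulr1//.
have : 1 <= n%:R - i%:R :> R by rewrite -natrB ?ler1n ?subn_gt0// ltnW.
lra.
Qed.

Lemma smooth_interp_cpt : smooth_cpt (smooth_interp S F n).
Proof.
case: stepS => d0 _ _ _ _.
have dn : 0 < d / n%:R by rewrite divr_gt0// ltr0n.
have supp : closure [set t | smooth_interp S F n t != 0] `<=`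
    `[d / n%:R, 1 - d / n%:R].
  rewrite closureE; apply: smallest_sub; first exact: interval_closed.
  by move=> t /= /smooth_interp_supp; rewrite in_itv.
split; first exact: smooth_interp_smooth.
split.
  exact: subclosed_compact (@closed_closure _ _) (@segment_compact _ _ _) supp.
apply: subset_trans supp _ => t /=; rewrite /I01 /= !in_itv /= => /andP[t1 t2].
by rewrite (lt_le_trans dn t1) (le_lt_trans t2)// gtrBl.
Qed.

End smooth_interp_theory.

End interpolation.

(** * The space L2(0,1) *)

Section square_integrable.
Context d (T : measurableType d) (R : realType).
Variable mu : {measure set T -> \bar R}.
Variables (D : set T) (mD : measurable D).
Implicit Types (u v h : T -> R) (f : nat -> T -> R) (c : R).

Definition square_integrable u :=
  measurable_fun D u /\ (\int[mu]_(t in D) ((u t) ^+ 2)%:E < +oo)%E.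

Lemma square_integrableP u : square_integrable u <->
  measurable_fun D u /\ mu.-integrable D (EFin \o (fun t => u t ^+ 2)).
Proof.
split=> [[m_u ufin]|[m_u /integrableP[_ ufin]]]; split=> //.
  apply/integrableP; split.
    by apply/measurable_EFinP; exact: measurable_funX.
  by under eq_integral do rewrite /= ger0_norm ?sqr_ge0//.
by under eq_integral do rewrite /= -[X in X%:E]ger0_norm ?sqr_ge0//.
Qed.

Lemma square_integrable_le u v : measurable_fun D u -> square_integrable v ->
  (forall t, D t -> `|u t| <= `|v t|) -> square_integrable u.
Proof.
move=> m_u /square_integrableP[_ iv] uv; apply/square_integrableP; split => //.
apply: le_integrable iv => //.
  by apply/measurable_EFinP; exact: measurable_funX.
move=> t Dt /=; rewrite lee_fin !normrX.
by rewrite lerXn2r ?nnegrE// uv.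
Qed.

Lemma square_integrable_cst c : (mu D < +oo)%E -> square_integrable (cst c).
Proof.
move=> Dfin; split; first exact: measurable_cst.
rewrite (@integral_cst _ _ _ mu D mD (c ^+ 2)%:E).
by rewrite lte_mul_pinfty ?lee_fin ?sqr_ge0.
Qed.

Lemma square_integrable_bounded u c : (mu D < +oo)%E -> measurable_fun D u ->
  (forall t, D t -> `|u t| <= c) -> square_integrable u.
Proof.
move=> Dfin m_u uc.
apply: square_integrable_le (square_integrable_cst c Dfin) _ => // t Dt.
by rewrite (le_trans (uc t Dt))// ler_norm.
Qed.

Lemma square_integrableD u v :
  square_integrable u -> square_integrable v -> square_integrable (u + v).
Proof.
move=> /square_integrableP[m_u iu] /square_integrableP[m_v iv].
apply/square_integrableP; split; first exact: measurable_funD.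
have iuv : mu.-integrable D (fun t => 2%:E * ((u t ^+ 2)%:E + (v t ^+ 2)%:E))%E.
  by apply: integrableZl => //; exact: integrableD.
apply: le_integrable iuv => //.
  by apply/measurable_EFinP; apply: measurable_funX; exact: measurable_funD.
move=> t Dt; rewrite addrfctE /= lee_fin ger0_norm ?sqr_ge0//.
rewrite ger0_norm; last first.
  by rewrite mulr_ge0// addr_ge0// sqr_ge0.
by have := sqr_ge0 (u t - v t); nra.
Qed.

Lemma square_integrableZ c u :
  square_integrable u -> square_integrable (c *: u).
Proof.
move=> /square_integrableP[m_u iu]; apply/square_integrableP; split.
  by apply: measurable_funM => //; exact: measurable_cst.
have : mu.-integrable D (fun t => (c ^+ 2)%:E * (u t ^+ 2)%:E)%E.
  exact: integrableZl.
by under eq_fun do rewrite /= -EFinM -exprMn.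
Qed.

Lemma square_integrable_mul u v : square_integrable u -> square_integrable v ->
  mu.-integrable D (EFin \o (fun t => u t * v t)).
Proof.
move=> /square_integrableP[m_u iu] /square_integrableP[m_v iv].
have iuv : mu.-integrable D (fun t => (u t ^+ 2)%:E + (v t ^+ 2)%:E)%E.
  exact: integrableD.
apply: le_integrable iuv => //.
  by apply/measurable_EFinP; exact: measurable_funM.
move=> t Dt /=; rewrite lee_fin [leRHS]ger0_norm ?addr_ge0 ?sqr_ge0//.
rewrite ler_norml; apply/andP; split.
  by have := sqr_ge0 (u t + v t); nra.
by have := sqr_ge0 (u t - v t); nra.
Qed.

Lemma square_integrable_eq0 u : square_integrable u ->
  \int[mu]_(t in D) u t ^+ 2 = 0 -> {ae mu, forall t, D t -> u t = 0}.
Proof.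
move=> /square_integrableP[m_u iu] u0.
have : (\int[mu]_(t in D) `|(u t ^+ 2)%:E|)%E = 0%E.
  under eq_integral do rewrite /= ger0_norm ?sqr_ge0//.
  by rewrite -[LHS]fineK ?integrable_fin_num// [fine _]u0.
move=> /(ae_eq_integral_abs mu mD) u2_ae0.
have : ae_eq mu D (fun t => (u t ^+ 2)%:E) (cst 0%E).
  by apply: u2_ae0; apply/measurable_EFinP; exact: measurable_funX.
by apply: filterS => t /= ut0 /ut0[] /eqP; rewrite sqrf_eq0 => /eqP.
Qed.

Lemma square_integrable_dominated_cvg f h : square_integrable h ->
  (forall n, measurable_fun D (f n)) ->
  (forall n t, D t -> `|f n t| <= h t) ->
  (forall t, D t -> f ^~ t @ \oo --> (0 : R)) ->
  \int[mu]_(t in D) f n t ^+ 2 @[n --> \oo] --> (0 : R).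
Proof.
move=> /square_integrableP[_ ih] mf fh f0; apply: fine_cvg.
have -> : 0%:E = (\int[mu]_(t in D) (cst 0 t))%E by rewrite integral0.
apply: (@dominated_cvg _ _ _ mu _ _ _ (cst 0%E) (fun t => (h t ^+ 2)%:E)) => //.
- by move=> n; apply/measurable_EFinP; apply: measurable_funX; exact: mf.
- move=> t Dt; apply: cvg_EFin; first exact: nearW.
  rewrite (_ : 0 = 0 ^+ 2 :> R); last by rewrite expr0n.
  apply: (@cvg_comp _ _ _ _ (fun x : R => x ^+ 2) _ _ _ (f0 t Dt)).
  exact: exprn_continuous.
- move=> n t Dt /=; rewrite lee_fin normrX lerXn2r ?nnegrE ?fh//.
  exact: le_trans (fh n t Dt).
Qed.

End square_integrable.

Section L2_space.
Variable R : realType.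
Local Notation mu := (@lebesgue_measure R).

Definition L2pred : {pred (R -> R)} := fun u => `[< inL2 u >].

Record L2 := MkL2 { L2fun :> R -> R; _ : L2fun \in L2pred }.

HB.instance Definition _ := [isSub of L2 for L2fun].
HB.instance Definition _ := [Choice of L2 by <:].

Lemma measurable_I01 : measurable (@I01 R).
Proof. exact: measurable_itv. Qed.
#[local] Hint Resolve measurable_I01 : core.

Lemma lebesgue_I01_lty : (mu (@I01 R) < +oo)%E.
Proof.
by rewrite /I01 lebesgue_measure_itv /= lte_fin ltr01 oppr0 adde0 ltry.
Qed.
#[local] Hint Resolve lebesgue_I01_lty : core.

Lemma L2pred_submod_closed : submod_closed L2pred.
Proof.
split=> [|c u v /asboolP iu /asboolP iv]; apply/asboolP.
  exact: (@square_integrable_cst _ _ _ mu _ _ 0).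
apply: (@square_integrableD _ _ _ mu) => //.
exact: (@square_integrableZ _ _ _ mu).
Qed.

HB.instance Definition _ :=
  GRing.isSubmodClosed.Build _ _ L2pred L2pred_submod_closed.
HB.instance Definition _ := [SubChoice_isSubLmodule of L2 by <:].

Implicit Types (u v w x y z : L2) (f g : R -> R) (c lam r : R).

Lemma L2_inL2 u : inL2 u.
Proof. by case: u => f /= /asboolP. Qed.

(* The zero function when [f] is not square integrable. *)
Definition toL2 f : L2 := insubd 0 f.

Lemma toL2K f : inL2 f -> toL2 f = f :> (R -> R).
Proof. by move=> /asboolP f2; exact: insubdK. Qed.

Lemma L2_subE u v t : (u - v) t = u t - v t.
Proof. by []. Qed.

Lemma L2_scaleE c u t : (c *: u) t = c * u t.
Proof. by []. Qed.

Lemma L2_sumE n (u : 'I_n -> L2) t :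
  (\sum_(i < n) u i : L2) t = \sum_(i < n) u i t.
Proof. exact: (big_morph (fun u : L2 => u t)). Qed.

End L2_space.
Arguments measurable_I01 {R}.
Arguments lebesgue_I01_lty {R}.

(* Locked, lest the unification of two inner products compare the integrals. *)
HB.lock Definition L2dot (R : realType) (u v : L2 R) : R :=
  \int[@lebesgue_measure R]_(t in @I01 R) (u t * v t).

Section L2_inner_product.
Variable R : realType.
Local Notation mu := (@lebesgue_measure R).
Local Notation L2 := (L2 R).
Implicit Types (u v w : L2) (f : R -> R) (c r : R).
#[local] Hint Extern 0 (_.-measurable (@I01 _)) => exact: measurable_I01 : core.
#[local] Hint Resolve lebesgue_I01_lty : core.

Lemma L2_mul_integrable u v :
  mu.-integrable (@I01 R) (EFin \o (fun t => u t * v t)).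
Proof. by apply: square_integrable_mul => //; exact: L2_inL2. Qed.

Let L2dotC u v : L2dot u v = L2dot v u.
Proof. by rewrite unlock; apply: eq_Rintegral => t _; rewrite mulrC. Qed.

Let L2dotDl u v w : L2dot (u + v) w = L2dot u w + L2dot v w.
Proof.
rewrite unlock -RintegralD//; last 2 first.
- exact: L2_mul_integrable.
- exact: L2_mul_integrable.
by apply: eq_Rintegral => t _; rewrite mulrDl.
Qed.

Let L2dotZl c u w : L2dot (c *: u) w = c * L2dot u w.
Proof.
rewrite unlock -RintegralZl//; last exact: L2_mul_integrable.
by apply: eq_Rintegral => t _; rewrite /= mulrA.
Qed.

Let L2dot_ge0 u : 0 <= L2dot u u.
Proof.
by rewrite unlock; apply: Rintegral_ge0 => t _; rewrite -expr2 sqr_ge0.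
Qed.

HB.instance Definition _ :=
  Lmodule_isSemiInner.Build R L2 L2dotC L2dotDl L2dotZl L2dot_ge0.

(* The seminorm of a semi-inner product space is keyed on [SemiInner.sort]. *)
HB.instance Definition _ :=
  Num.SemiNormedZmodule.copy L2 (SemiInner.sort (L2 : semiInnerType R)).

Lemma L2_dotE u v : '[u, v] = \int[mu]_(t in @I01 R) (u t * v t).
Proof. by transitivity (L2dot u v); [|rewrite unlock]. Qed.

Lemma L2_integral_mulE u v :
  (\int[mu]_(t in @I01 R) (u t * v t)%:E)%E = '[u, v]%:E.
Proof.
rewrite L2_dotE fineK//; apply: integrable_fin_num => //.
exact: L2_mul_integrable.
Qed.

Lemma L2norm2E u : L2norm2 u = (`|u| ^+ 2)%:E.
Proof. by rewrite sqr_norm -L2_integral_mulE. Qed.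

Lemma L2_norm_eq0_ae u : `|u| = 0 -> {ae mu, forall t, I01 t -> u t = 0}.
Proof.
move=> u0; apply: (@square_integrable_eq0 _ _ _ mu) => //; first exact: L2_inL2.
by transitivity (`|u| ^+ 2); [rewrite sqr_norm L2_dotE|rewrite u0 expr0n].
Qed.

Lemma L2_dot_le u v w : (forall t, I01 t -> u t * w t <= v t * w t) ->
  '[u, w] <= '[v, w].
Proof.
by move=> uv; rewrite !L2_dotE le_Rintegral//; exact: L2_mul_integrable.
Qed.

Lemma L2_dominated_norm_le (u : nat -> L2) f r : inL2 f -> 0 < r ->
  (forall n t, I01 t -> `|u n t| <= f t) ->
  (forall t, I01 t -> u ^~ t @ \oo --> (0 : R)) -> exists n, `|u n| <= r.
Proof.
move=> f2 r0 uf u0.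
have mu_ n : measurable_fun (@I01 R) (u n) by case: (L2_inL2 (u n)).
have /cvgr0Pnorm_le := @square_integrable_dominated_cvg _ _ _ mu _
  measurable_I01 u f f2 mu_ uf u0.
move=> /(_ _ (exprn_gt0 2 r0))[n _ /(_ n (leqnn n))].
rewrite (_ : Rintegral _ _ _ = `|u n| ^+ 2); last by rewrite sqr_norm L2_dotE.
by rewrite ger0_norm ?sqr_ge0// ler_pXn2r ?nnegrE ?(ltW r0)//; exists n.
Qed.

Lemma continuous_bounded01 f : continuous f ->
  exists c, forall t, t \in `[0, 1] -> `|f t| <= c.
Proof.
move=> cf; have [|s _ f_le] := @EVT_max R (fun t => `|f t|) 0 1 ler01.
  apply: continuous_subspaceT => t.
  by apply: continuous_comp; [exact: cf|exact: norm_continuous].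
by exists `|f s|.
Qed.

Lemma inL2_bounded f c : measurable_fun (@I01 R) f ->
  (forall t, I01 t -> `|f t| <= c) -> inL2 f.
Proof.
move=> mf fc; apply: (@square_integrable_bounded _ _ _ mu _ _ _ c) => //.
exact: lebesgue_I01_lty.
Qed.

Lemma continuous_inL2 f : continuous f -> inL2 f.
Proof.
move=> cf; have [c f_le] := continuous_bounded01 cf.
apply: (@inL2_bounded _ c) => [|t].
  by apply: measurable_funTS; exact: continuous_measurable_fun.
by rewrite /I01 /= in_itv /= => /andP[t0 t1]; rewrite f_le// in_itv /= !ltW.
Qed.

Lemma L2_integrable u : mu.-integrable (@I01 R) (EFin \o u).
Proof.
have one : inL2 (fun=> 1 : R) by apply/continuous_inL2/cst_continuous.
have := L2_mul_integrable u (toL2 (fun=> 1)); rewrite toL2K//.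
by under eq_fun do rewrite mulr1.
Qed.

Lemma derive1_inL2 f : smooth f -> inL2 (derive1 f).
Proof.
by move=> sf; exact/continuous_inL2/smooth_continuous/smooth_derive1.
Qed.

End L2_inner_product.

(** * The total variation *)

Section total_variation.
Variable R : realType.
Local Notation mu := (@lebesgue_measure R).
Implicit Types (u v w x y z : L2 R) (f g phi : R -> R) (c lam r : R).

Definition test_function phi := smooth_cpt phi /\ forall t, `|phi t| <= 1.

Definition test_derivatives : set (L2 R) :=
  [set toL2 (derive1 phi) | phi in test_function].

Lemma TV_leP u c : (TV u <= c%:E)%E <-> support_le test_derivatives u c.
Proof.
have TVE phi : test_function phi ->
    (\int[mu]_(t in @I01 R) (u t * derive1 phi t)%:E)%E =
    '[u, toL2 (derive1 phi)]%:E.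
  move=> [[sphi _] _]; rewrite -L2_integral_mulE toL2K//.
  exact: derive1_inL2.
split=> [uc _ [phi tphi <-]|uc].
  rewrite -lee_fin -TVE//; apply: le_trans uc.
  by apply: ereal_sup_ubound; exists phi.
apply: ge_ereal_sup => _ [phi tphi <-].
by rewrite TVE// lee_fin uc//; exists phi.
Qed.

Lemma test_function0 : test_function (fun=> 0).
Proof.
split; last by move=> t; rewrite normr0.
split; first exact: smooth_cst.
have -> : [set t : R | 0 != 0 :> R] = set0.
  by apply/seteqP; split => t //=; rewrite eqxx.
by rewrite closure0; split; [exact: compact0|exact: sub0set].
Qed.

Lemma TV_ge0 f : (0 <= TV f)%E.
Proof.
apply: ereal_sup_ubound; exists (fun=> 0); first exact: test_function0.
rewrite (_ : derive1 _ = fun=> 0); last first.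
  by apply/funext => t; rewrite derive1_cst.
by under eq_integral do rewrite mulr0; rewrite integral0.
Qed.

Lemma tikhE lam y z x :
  tikh lam y z x = ((lam / 2 * `|x - y| ^+ 2)%:E + TV (x - z)%R)%E.
Proof. by rewrite EFinM -L2norm2E. Qed.

Lemma is_minimizer_subgradient lam y z x : 0 < lam -> is_minimizer lam y z x ->
  subgradient test_derivatives (lam *: (y - x)) (x - z).
Proof.
move=> lam0 [_ xmin].
have {}xmin w c : support_le test_derivatives (w - z) c ->
    ((lam / 2 * `|x - y| ^+ 2)%:E + TV (x - z)%R <=
     (lam / 2 * `|w - y| ^+ 2 + c)%:E)%E.
  move=> /TV_leP wc; rewrite -tikhE (le_trans (xmin w (L2_inL2 w)))//.
  by rewrite tikhE EFinD leeD2l.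
have [T TE] : exists T, TV (x - z) = T%:E.
  have := xmin z 0; rewrite subrr => /(_ (@support_le0 _ _ _)).
  by have := TV_ge0 (x - z); case: (TV _) => // T _ _; exists T.
apply: (@minimizer_subgradient _ _ _ _ _ _ _ T) => //.
  by apply/TV_leP; rewrite TE.
by move=> w c /xmin; rewrite TE.
Qed.

End total_variation.

(** * Step functions *)

Section step_functions.
Variable R : realType.
Local Notation mu := (@lebesgue_measure R).
Implicit Types (u : L2 R) (b c F : nat -> R) (S phi : R -> R) (d e r t : R).
Implicit Types (i j m n : nat).

Definition cell_itv n i : set R := `[i%:R / n%:R, i.+1%:R / n%:R[.

Definition cell n i : L2 R := toL2 \1_(cell_itv n i).

Definition step n b : L2 R := \sum_(i < n) b i *: cell n i.

Lemma cellE n i t : cell n i t = (t \in cell_itv n i)%:R.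
Proof.
rewrite /cell toL2K ?indicE//.
apply: (@inL2_bounded _ _ 1) => [|s _].
  by apply: measurable_funTS; apply: measurable_indic; exact: measurable_itv.
by rewrite indicE; case: (_ \in _); rewrite ?normr1 ?normr0.
Qed.

Lemma cell_disjoint n i j t : cell_itv n i t -> cell_itv n j t -> i = j.
Proof.
rewrite /cell_itv /= !in_itv /= => /andP[it ti] /andP[jt tj].
have n0 : 0 < n%:R :> R.
  rewrite ltr0n lt0n; apply/eqP => n0; move: (le_lt_trans it ti).
  by rewrite n0 invr0 !mulr0 ltxx.
have := le_lt_trans it tj; have := le_lt_trans jt ti.
by rewrite !ltr_pM2r ?invr_gt0// !ltr_nat; lia.
Qed.

Lemma stepE n b t i : (i < n)%N -> cell_itv n i t -> step n b t = b i.
Proof.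
move=> ilt it; rewrite /step L2_sumE (bigD1 (Ordinal ilt))//.
rewrite big1 => [|j /andP[_ ji]].
  by rewrite L2_scaleE cellE mem_set//= mulr1 addr0.
rewrite L2_scaleE cellE memNset ?mulr0// => /(cell_disjoint it) ijE.
by move: ji; rewrite -(inj_eq val_inj)/= ijE eqxx.
Qed.

Lemma step_ext n b c :
  (forall i, (i < n)%N -> b i = c i) -> step n b = step n c.
Proof. by move=> bc; apply: eq_bigr => i _; rewrite bc. Qed.

Lemma stepB n b c : step n b - step n c = step n (b - c).
Proof. by rewrite /step -sumrB; apply: eq_bigr => i _; rewrite -scalerBl. Qed.

Lemma stepD n b c : step n b + step n c = step n (b + c).
Proof.
by rewrite /step -big_split /=; apply: eq_bigr => i _; rewrite -scalerDl.
Qed.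

Lemma stepZ n r b : r *: step n b = step n (fun i => r * b i).
Proof.
by rewrite /step scaler_sumr; apply: eq_bigr => i _; rewrite scalerA.
Qed.

Lemma dot_cell n i u : (i < n)%N ->
  '[cell n i, u] = \int[mu]_(t in cell_itv n i) u t.
Proof.
move=> ilt; have n0 : 0 < n%:R :> R by rewrite ltr0n; lia.
rewrite L2_dotE /I01 Rintegral_itv_obnd_cbnd; last exact: L2_mul_integrable.
have cell_sub : `[0, 1[%classic `&` cell_itv n i = cell_itv n i.
  apply/setIidPr => t; rewrite /cell_itv /= !in_itv /= => /andP[it ti].
  rewrite (le_trans _ it) ?divr_ge0//=.
  by rewrite (lt_le_trans ti)// ler_pdivrMr// mul1r ler_nat.
rewrite -cell_sub Rintegral_mkcondr; apply: eq_Rintegral => t _.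
by rewrite cellE patchE; case: (t \in _); rewrite ?mul1r ?mul0r.
Qed.

Lemma Rintegral_derive1 phi (a b : R) : smooth phi -> a < b ->
  \int[mu]_(t in `[a, b[) derive1 phi t = phi b - phi a.
Proof.
move=> sphi ab; have cphi := smooth_continuous sphi.
have cphi' := smooth_continuous (smooth_derive1 sphi).
have wphi' : {within `[a, b], continuous (derive1 phi)}.
  exact: continuous_subspaceT.
have iphi' : mu.-integrable `[a, b] (EFin \o derive1 phi).
  apply: continuous_compact_integrable => //; exact: segment_compact.
rewrite Rintegral_itv_bndo_bndc; last first.
  apply: integrableS iphi' => //.
  by apply: subset_itvl; rewrite bnd_simp.
rewrite /Rintegral (continuous_FTC2 ab wphi' (F := phi))//.
split.
- by move=> t _; exact: (sphi 0%N).
- by apply: cvg_at_right_filter; exact: cphi.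
- by apply: cvg_at_left_filter; exact: cphi.
Qed.

Lemma node_lt n i : (i < n)%N -> i%:R / n%:R < i.+1%:R / n%:R :> R.
Proof. by move=> ilt; rewrite ltr_pM2r ?ltr_nat// invr_gt0 ltr0n; lia. Qed.

Lemma lebesgue_cell n i : (i < n)%N -> mu (cell_itv n i) = (n%:R^-1)%:E.
Proof.
move=> ilt; rewrite /cell_itv lebesgue_measure_itv /= lte_fin node_lt//.
by rewrite -EFinD -mulrBl -natr1 addrAC subrr add0r mul1r.
Qed.

Lemma dot_cell_derive1 n i phi : (i < n)%N -> smooth phi ->
  '[cell n i, toL2 (derive1 phi)] = phi (i.+1%:R / n%:R) - phi (i%:R / n%:R).
Proof.
move=> ilt sphi; rewrite dot_cell// -Rintegral_derive1 ?node_lt//.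
by rewrite toL2K//; exact: derive1_inL2.
Qed.

Lemma dot_cell_cell n i j : (i < n)%N ->
  '[cell n i, cell n j] = (i == j)%:R / n%:R.
Proof.
move=> ilt; rewrite dot_cell// (@eq_Rintegral _ _ _ _ _ (cst (i == j)%:R)).
  rewrite Rintegral_cst; last exact: measurable_itv.
  congr (_ * _); exact: (congr1 fine (lebesgue_cell ilt)).
move=> t /set_mem it; rewrite cellE /=; have [<-|ij] := eqVneq i j.
  by rewrite mem_set.
by rewrite memNset// => /(cell_disjoint it)/eqP; rewrite (negPf ij).
Qed.

Lemma dot_step n b u : '[step n b, u] = \sum_(i < n) b i * '[cell n i, u].
Proof. by rewrite dot_suml; apply: eq_bigr => i _; rewrite dotZl. Qed.

Lemma dot_step_step n b c :
  '[step n b, step n c] = n%:R^-1 * \sum_(i < n) b i * c i.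
Proof.
rewrite dot_step mulr_sumr; apply: eq_bigr => i _.
rewrite dotC dot_step (bigD1 i)//= big1 ?addr0 => [|j ji].
  by rewrite dot_cell_cell// eqxx mul1r; ring.
by rewrite dot_cell_cell// (inj_eq val_inj) (negPf ji) mul0r mulr0.
Qed.

Lemma smooth_cpt_ends phi : smooth_cpt phi -> phi 0 = 0 /\ phi 1 = 0.
Proof.
have I01N t : smooth_cpt phi -> ~ I01 t -> phi t = 0.
  move=> [_ [_ supp]] It; apply/eqP/negPn/negP => phit.
  by apply: It; apply: supp; exact: subset_closure.
by move=> sphi; split; apply: I01N => //; rewrite /I01 /= in_itv /= ltxx ?andbF.
Qed.

Lemma support_le_step m b : support_le (@test_derivatives R) (step m.+1 b)
  (\sum_(i < m) `|b i.+1 - b i|).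
Proof.
move=> _ [phi [cphi phi1] <-]; have [phi_0 phi_1] := smooth_cpt_ends cphi.
have [sphi _] := cphi.
have -> : '[step m.+1 b, toL2 (derive1 phi)] =
    \sum_(i < m.+1) (phi (i.+1%:R / m.+1%:R) - phi (i%:R / m.+1%:R)) * b i.
  by rewrite dot_step; apply: eq_bigr => i _; rewrite dot_cell_derive1// mulrC.
rewrite (sum_by_parts0 (F := fun i => phi (i%:R / m.+1%:R))); last 2 first.
- by rewrite mul0r.
- by rewrite divff ?pnatr_eq0.
rewrite -sumrN; apply: ler_sum => i _.
by rewrite (le_trans (ler_norm _))// normrN normrM ler_piMl.
Qed.

Definition step_slope S n i : L2 R :=
  toL2 (fun t => derive1 S (n%:R * t - i%:R)).

Lemma step_slopeE S n i t : smooth S ->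
  step_slope S n i t = derive1 S (n%:R * t - i%:R).
Proof.
move=> sS; rewrite toL2K//; apply/continuous_inL2/smooth_continuous.
exact/smooth_affine/smooth_derive1.
Qed.

Lemma dot_cell_step_slope e d S n i m j : smooth_step e d S -> (0 < n)%N ->
  (j < m)%N -> n%:R * (j%:R / m%:R) <= i%:R :> R ->
  i.+1%:R <= n%:R * (j.+1%:R / m%:R) :> R ->
  '[cell m j, step_slope S n i] = n%:R^-1.
Proof.
move=> [d0 sS S0 S1 _] n_gt0 jm ji ij.
have n0 : n%:R != 0 :> R by rewrite pnatr_eq0 -lt0n.
pose sigma t := n%:R^-1 * S (n%:R * t - i%:R).
have s_sigma : smooth sigma.
  by apply: smoothM; [exact: smooth_cst|exact: smooth_affine].
rewrite /step_slope (_ : (fun t => _) = derive1 sigma); last first.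
  apply/esym/is_derive_derive1E => t.
  have := is_derive_affine (smooth_is_derive sS (n%:R * t - i%:R)).
  by move=> /(is_deriveZ n%:R^-1); rewrite /GRing.scale /= mulKf.
rewrite dot_cell_derive1// /sigma S1 ?S0 ?mulr0 ?subr0 ?mulr1//.
- by rewrite (le_trans _ (ltW d0))// subr_le0.
- by rewrite lerBrDr (le_trans _ ij)// -natr1 addrC lerD2l gerBl ltW.
Qed.

(* The slope and the cell have the same product with the cell, so that their
   distance is governed by the square norm of the slope. *)
Lemma norm_step_slope_sub_cell e d S n i : smooth_step e d S -> (i < n)%N ->
  `|step_slope S n i - cell n i| ^+ 2 <= e / n%:R.
Proof.
move=> stepS ilt; have [_ sS _ _ dS] := stepS.
have n_gt0 : (0 < n)%N by exact: leq_ltn_trans ilt.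
have n0 : n%:R != 0 :> R by rewrite pnatr_eq0 -lt0n.
set s := step_slope S n i.
have cell_s : '[cell n i, s] = n%:R^-1.
  by apply: (dot_cell_step_slope stepS); rewrite // mulrCA divff ?mulr1.
have unit_s : '[cell 1 0, s] = n%:R^-1.
  apply: (dot_cell_step_slope stepS); rewrite // ?mul0r ?mulr0 ?divr1 ?mulr1//.
  by rewrite ler_nat.
have s_s : '[s, s] <= (1 + e) / n%:R.
  rewrite -unit_s -dotZl; apply: L2_dot_le => t It.
  have /andP[s_ge0 s_le] := dS (n%:R * t - i%:R).
  rewrite L2_scaleE cellE mem_set ?mulr1; last first.
    move: It; rewrite /I01 /cell_itv /= !in_itv /= mul0r divr1 => /andP[t0 ->].
    by rewrite (ltW t0).
  by rewrite step_slopeE// ler_wpM2r.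
rewrite sqr_normB (dotC s) cell_s dot_cell_cell// eqxx mul1r.
by move: s_s; rewrite mulrDl mul1r; lra.
Qed.

(* The derivative of the polygonal line through the points [(i / n, F i)]. *)
Definition polygon_derivative n F : L2 R :=
  step n (fun i => n%:R * (F i.+1 - F i)).

Lemma polygon_derivative_adherent n F : (0 < n)%N ->
  F 0%N = 0 -> F n = 0 -> (forall i, `|F i| <= 1) ->
  adherent (@test_derivatives R) (polygon_derivative n F).
Proof.
move=> n_gt0 F0 Fn F1 r r0.
have nR0 : 0 < n%:R :> R by rewrite ltr0n.
pose e := n%:R * (r / (2 * n%:R ^+ 2)) ^+ 2.
have q0 : 0 < r / (2 * n%:R ^+ 2) by rewrite divr_gt0// mulr_gt0// exprn_gt0.
have e0 : 0 < e by rewrite mulr_gt0// exprn_gt0.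
have [S [d stepS]] := smooth_step_exists e0.
have [_ sS _ _ _] := stepS.
have cpt := smooth_interp_cpt stepS n_gt0 F0 Fn.
exists (toL2 (derive1 (smooth_interp S F n))).
  exists (smooth_interp S F n) => //; split=> // t.
  exact: (smooth_interp_le1 n stepS).
have -> : toL2 (derive1 (smooth_interp S F n)) =
    \sum_(i < n) (n%:R * (F i.+1 - F i)) *: step_slope S n i.
  apply: val_inj; apply/funext => t; rewrite /= L2_sumE toL2K; last first.
    by apply: derive1_inL2; case: cpt.
  rewrite (derive1_smooth_interp F n stepS); apply: eq_bigr => i _.
  by rewrite L2_scaleE step_slopeE.
rewrite distrC -sumrB (le_trans (ler_norm_sum _ _ _))//.
apply: (@le_trans _ _ (\sum_(i < n) n%:R * 2 * (r / (2 * n%:R ^+ 2)))).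
  apply: ler_sum => i _; rewrite -scalerBr normZ normrM (ger0_norm (ltW nR0)).
  apply: ler_pM; rewrite ?mulr_ge0//.
    rewrite ler_pM2l// (le_trans (ler_normB _ _))//.
    by rewrite (_ : 2 = 1 + 1)// lerD.
  rewrite -(@ler_pXn2r _ 2) ?nnegrE ?(ltW q0)//.
  apply: le_trans (norm_step_slope_sub_cell stepS (ltn_ord i)) _.
  by rewrite /e mulrC mulKf// gt_eqF.
rewrite sumr_const card_ord -mulr_natr le_eqVlt; apply/orP; left; apply/eqP.
by field; rewrite gt_eqF.
Qed.

Lemma step_subgradient m F b :
  F 0%N = 0 -> F m.+1 = 0 -> (forall i, `|F i| <= 1) ->
  (forall i, (i.+1 < m.+1)%N -> opposed (F i.+1) (b i.+1 - b i)) ->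
  subgradient (@test_derivatives R) (polygon_derivative m.+1 F) (step m.+1 b).
Proof.
move=> F0 Fm F1 Fb; split.
  exact/adherent_below_support/polygon_derivative_adherent.
rewrite (_ : '[_, _] = \sum_(i < m) `|b i.+1 - b i|).
  exact: support_le_step.
rewrite dot_step_step mulr_sumr.
under eq_bigr do rewrite -mulrA mulKf ?pnatr_eq0//.
rewrite sum_by_parts0// -sumrN; apply: eq_bigr => i _.
by rewrite (opposed_norm (F1 _) (Fb _ _))// ltnS.
Qed.

End step_functions.

(** * Density of step functions *)

Section clamp.
Variable R : realType.
Implicit Types (k s t : R) (f : R -> R) (D : set R).

Definition clamp k t : R := Num.max (- k) (Num.min k t).

Lemma clampP k t : 0 <= k -> [\/ t <= - k /\ clamp k t = - k,
  - k <= t <= k /\ clamp k t = t | k <= t /\ clamp k t = k].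
Proof.
move=> k0; rewrite /clamp; have [tk|kt] := leP t k; last first.
  by constructor 3; rewrite ltW// max_r//; lra.
have [tk'|kt] := leP t (- k); first by constructor 1.
by constructor 2; rewrite (ltW kt).
Qed.

Lemma norm_clamp_le k t : 0 <= k -> `|clamp k t| <= k.
Proof.
move=> k0; rewrite ler_norml.
by case: (clampP t k0) => -[tk ->] //; rewrite lexx; lra.
Qed.

Lemma clamp_id k t : `|t| <= k -> clamp k t = t.
Proof.
move=> tk; have k0 := le_trans (normr_ge0 t) tk.
move: tk; rewrite ler_norml => /andP[? ?].
by case: (clampP t k0) => -[? ->]; lra.
Qed.

Lemma clamp_lipschitz k s t : 0 <= k -> `|clamp k s - clamp k t| <= `|s - t|.
Proof.
move=> k0; wlog ts : s t / t <= s.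
  move=> H; have [|/ltW] := leP t s; first exact: H.
  by move=> /H; rewrite distrC [X in _ -> _ <= X]distrC.
rewrite [leRHS]ger0_norm ?subr_ge0// ler_norml.
case: (clampP s k0) => -[? ->]; case: (clampP t k0) => -[? ->];
  by apply/andP; split; lra.
Qed.

Lemma norm_sub_clamp_le k t : 0 <= k -> `|t - clamp k t| <= `|t|.
Proof.
move=> k0; case: (clampP t k0) => -[tk ->].
- by rewrite !ler0_norm; lra.
- by rewrite subrr normr0.
- by rewrite !ger0_norm; lra.
Qed.

Lemma continuous_clamp k f : continuous f -> continuous (clamp k \o f).
Proof.
move=> cf t.
have cmin : {for t, continuous (cst k \min (f : R -> R^o))}.
  by apply: continuous_min; [exact: cst_continuous|exact: cf].
apply: (@continuous_max _ _ (cst (- k)) (cst k \min f) t _ cmin).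
exact: cst_continuous.
Qed.

Lemma measurable_clamp k f D :
  measurable_fun D f -> measurable_fun D (clamp k \o f).
Proof.
move=> mf; apply: measurable_maxr; first exact: measurable_cst.
by apply: measurable_minr => //; exact: measurable_cst.
Qed.

End clamp.

Section density.
Variable R : realType.
Local Notation mu := (@lebesgue_measure R).
Implicit Types (u y : L2 R) (f g : R -> R) (k e t : R) (n i : nat).

Definition bounded_L2 : set (L2 R) :=
  [set u | exists k, forall t, `|u t| <= k].

Definition continuous_L2 : set (L2 R) := [set u | continuous u].

Definition step_functions : set (L2 R) :=
  [set u | exists n b, u = step n.+1 b].

Lemma clamp_inL2 k y : 0 <= k -> inL2 (clamp k \o y).
Proof.
move=> k0; apply: (@inL2_bounded _ _ k) => [|t _]; last exact: norm_clamp_le.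
by apply: measurable_clamp; case: (L2_inL2 y).
Qed.

Lemma bounded_dense y : adherent bounded_L2 y.
Proof.
move=> r r0; pose v n := toL2 (clamp n%:R \o y).
have vE n t : v n t = clamp n%:R (y t).
  by rewrite (toL2K (clamp_inL2 y (ler0n R n))).
have y_norm : inL2 (fun t => `|y t|).
  apply: (@square_integrable_le _ _ _ mu _ _ _ y) (L2_inL2 y) _.
  - exact: measurable_I01.
  - by apply: measurableT_comp => //; case: (L2_inL2 y).
  - by move=> t _; rewrite normr_id.
have [||n yv] := L2_dominated_norm_le (u := fun n => y - v n) y_norm r0.
- by move=> n t _; rewrite L2_subE vE norm_sub_clamp_le.
- move=> t _; apply: cvg_near_cst; exists (Num.truncn `|y t|).+1 => // n tn.
  rewrite L2_subE vE clamp_id ?subrr// ltW//.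
  have /andP[_ yt] := truncn_itv (normr_ge0 (y t)).
  by rewrite (lt_le_trans yt)// ler_nat.
by exists (v n) => //; exists n%:R => t; rewrite vE norm_clamp_le.
Qed.

Lemma continuous_dense_L1 D f e : measurable D -> (mu D < +oo)%E ->
  mu.-integrable D (EFin \o f) -> 0 < e ->
  exists g, [/\ continuous g, mu.-integrable D (EFin \o g) &
    \int[mu]_(t in D) `|f t - g t| <= e].
Proof.
move=> mD Dfin intf e0.
have [g [cg intg]] := approximation_continuous_integrable mD Dfin intf.
move=> /fine_cvgP[_ /cvgrPdist_le /(_ e e0)[n _ /(_ n (leqnn n))]].
rewrite /= sub0r normrN => gn; exists (g n); split=> //.
by rewrite (le_trans (ler_norm _)).
Qed.

Lemma sqr_norm_sub_clamp_le u g k :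
  (forall t, `|u t| <= k) -> 0 <= k -> continuous g ->
  mu.-integrable (@I01 R) (EFin \o (fun t => `|u t - g t|)) ->
  `|u - toL2 (clamp k \o g)| ^+ 2 <=
  2 * k * \int[mu]_(t in @I01 R) `|u t - g t|.
Proof.
move=> uk k0 cg intug; rewrite sqr_norm L2_dotE -RintegralZl//; last first.
  exact: measurable_I01.
apply: le_Rintegral.
- exact: measurable_I01.
- exact: L2_mul_integrable.
- suff : mu.-integrable (@I01 R)
    (fun t => (2 * k)%:E * `|u t - g t|%:E)%E by [].
  by apply: integrableZl => //; exact: measurable_I01.
move=> t _.
rewrite L2_subE toL2K; last first.
  exact/continuous_inL2/continuous_clamp.
rewrite -expr2 -real_normK ?num_real// expr2 ler_pM//.
  by rewrite (le_trans (ler_normB _ _))// mulr_natl mulr2n lerD// norm_clamp_le.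
by rewrite -{1}(clamp_id (uk t)) clamp_lipschitz.
Qed.

Lemma continuous_dense_bounded : bounded_L2 `<=` adherent continuous_L2.
Proof.
move=> u [k uk] r r0; have k0 : 0 <= k by exact: le_trans (normr_ge0 _) (uk 0).
pose e := r ^+ 2 / (2 * k + 1).
have K1 : 0 < 2 * k + 1 by rewrite ltr_wpDl// mulr_ge0.
have e0 : 0 < e by rewrite divr_gt0// exprn_gt0.
have [g [cg intg gE]] :=
  continuous_dense_L1 measurable_I01 lebesgue_I01_lty
    (L2_integrable u) e0.
have ccg := continuous_clamp (k := k) cg.
have intug : mu.-integrable (@I01 R) (fun t => (u t)%:E - (g t)%:E)%E.
  by apply: integrableB => //; [exact: measurable_I01|exact: L2_integrable].
exists (toL2 (clamp k \o g)).
  by rewrite /continuous_L2 /= toL2K//; exact: continuous_inL2.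
rewrite -(@ler_pXn2r _ 2) ?nnegrE ?(ltW r0)//.
apply: le_trans (sqr_norm_sub_clamp_le uk k0 cg (integrable_abse intug)) _.
apply: (@le_trans _ _ (2 * k * e)); first by rewrite ler_wpM2l// mulr_ge0.
by rewrite /e mulrA ler_pdivrMr// mulrC ler_wpM2l ?sqr_ge0// lerDl.
Qed.

Lemma cell_cover n t : I01 t -> exists2 i, (i < n.+1)%N & cell_itv n.+1 i t.
Proof.
rewrite /I01 /= in_itv /= => /andP[t0 t1].
have n0 : 0 < n.+1%:R :> R by rewrite ltr0n.
have nt0 : 0 <= n.+1%:R * t by rewrite mulr_ge0// ltW.
have /andP[trunc_le lt_trunc] := truncn_itv nt0.
exists (Num.truncn (n.+1%:R * t)).
  by rewrite -(ltr_nat R) (le_lt_trans trunc_le)// gtr_pMr.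
rewrite /cell_itv /= in_itv /= ler_pdivrMr// ltr_pdivlMr// (mulrC t).
by rewrite trunc_le.
Qed.

Lemma node_itv n i : (i < n.+1)%N -> i%:R / n.+1%:R \in `[0, 1 : R].
Proof.
move=> ilt; rewrite in_itv /= divr_ge0//= ler_pdivrMr ?ltr0n//.
by rewrite mul1r ler_nat ltnW.
Qed.

Definition sample f n : L2 R := step n.+1 (fun i => f (i%:R / n.+1%:R)).

Lemma sample_cvg f t :
  continuous f -> I01 t -> sample f n t @[n --> \oo] --> f t.
Proof.
move=> cf It; apply/cvgrPdist_le => e e0.
have /cvgrPdist_le /(_ e e0) /nbhs_ballP[d /= d0 hd] := cf t.
exists (Num.truncn d^-1) => // n /= dn.
have [i ilt it] := cell_cover n It; rewrite (stepE _ ilt it).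
apply: hd; move: it; rewrite /cell_itv /ball /= in_itv /= => /andP[it ti].
rewrite ger0_norm ?subr_ge0//.
apply: (@lt_le_trans _ _ n.+1%:R^-1).
  by move: ti; rewrite ltrBlDl -natr1 mulrDl mul1r.
rewrite -[leRHS]invrK lef_pV2 ?posrE ?invr_gt0 ?ltr0n//.
have dV0 : 0 <= d^-1 by rewrite invr_ge0 ltW.
have /andP[_ dV] := truncn_itv dV0.
by rewrite ltW// (lt_le_trans dV)// ler_nat.
Qed.

Lemma step_dense_continuous : continuous_L2 `<=` adherent step_functions.
Proof.
move=> u cu r r0; have [k uk] := continuous_bounded01 cu.
have cstk : inL2 (fun=> k + k) by exact/continuous_inL2/cst_continuous.
have [||n un] := L2_dominated_norm_le (u := fun n => u - sample u n) cstk r0.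
- move=> n t It; have [i ilt it] := cell_cover n It.
  have t01 : t \in `[0, 1].
    by move: It; rewrite /I01 /= !in_itv /= => /andP[/ltW -> /ltW ->].
  rewrite L2_subE (stepE _ ilt it) (le_trans (ler_normB _ _))//.
  by rewrite lerD ?uk ?node_itv.
- move=> t It; rewrite -[0](subrr (u t)).
  by apply: cvgB; [exact: cvg_cst|exact: sample_cvg].
by exists (sample u n) => //; exists n; eexists.
Qed.

Lemma step_dense y : adherent step_functions y.
Proof.
apply: adherent_trans step_dense_continuous _.
exact: adherent_trans continuous_dense_bounded (bounded_dense y).
Qed.

End density.

(** * Nestedness of the minimizers *)

Section nestedness.
Variable R : realType.
Implicit Types (y u p x : L2 R) (b F : nat -> R) (lam : R) (m : nat).
Local Notation subgradient := (subgradient (@test_derivatives R)).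

Lemma step_residual lam m b F :
  step m.+1 b = step m.+1 (residual (m.+1%:R / lam) b F)
    + lam^-1 *: polygon_derivative m.+1 F.
Proof.
rewrite stepZ stepD; apply: step_ext => i _.
by rewrite addrfctE /residual; ring.
Qed.

Lemma step_nested lam1 lam2 m b : 0 < lam1 -> lam1 <= lam2 ->
  exists u1 p1 u2 p2,
  [/\ subgradient p1 u1, subgradient p2 u2, subgradient p2 (u2 - u1),
      step m.+1 b = u1 + lam1^-1 *: p1 & step m.+1 b = u2 + lam2^-1 *: p2].
Proof.
move=> lam1_gt0 lam12; have lam2_gt0 := lt_le_trans lam1_gt0 lam12.
have a1_gt0 : 0 < m.+1%:R / lam1 by rewrite divr_gt0.
have a2_gt0 : 0 < m.+1%:R / lam2 by rewrite divr_gt0.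
have a21 : m.+1%:R / lam2 <= m.+1%:R / lam1 by rewrite ler_pM2l// lef_pV2.
have [F1 t1] := taut_exists m.+1 b a1_gt0.
have [F2 t2] := taut_exists m.+1 b a2_gt0.
exists (step m.+1 (residual (m.+1%:R / lam1) b F1)),
  (polygon_derivative m.+1 F1),
  (step m.+1 (residual (m.+1%:R / lam2) b F2)),
  (polygon_derivative m.+1 F2).
case: (t1) (t2) => F10 F1n F1b F1x [F20 F2n F2b F2x].
split; try exact: step_subgradient; try exact: step_residual.
rewrite stepB; apply: step_subgradient => // i ilt.
exact: taut_diff_opposed a2_gt0 a21 t1 t2 ilt.
Qed.

Lemma subgradient_nested lam1 lam2 y x1 x2 : 0 < lam1 -> lam1 <= lam2 ->
  subgradient (lam1 *: (y - x1)) x1 -> subgradient (lam2 *: (y - x2)) x2 ->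
  subgradient (lam2 *: (y - x2)) (x2 - x1).
Proof.
move=> lam1_gt0 lam12 opt1 opt2; have lam2_gt0 := lt_le_trans lam1_gt0 lam12.
apply: subgradient_closed => r r0.
pose e := Num.min (r / 2) (lam2^-1 * r).
have e0 : 0 < e by rewrite lt_min !mulr_gt0// invr_gt0.
have [_ [m [b ->]] yb] := step_dense y e0.
have [u1 [p1 [u2 [p2 [sub1 sub2 sub21 bE1 bE2]]]]] :=
  step_nested m b lam1_gt0 lam12.
have y_split lam x : 0 < lam -> y = x + lam^-1 *: (lam *: (y - x)).
  by move=> lam0; rewrite scalerA mulVf ?gt_eqF// scale1r addrC subrK.
have x1u1 : `|x1 - u1| <= e.
  apply: le_trans yb; rewrite bE1 [in leRHS](y_split _ x1 lam1_gt0).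
  by apply: resolvent_nonexpansive opt1 sub1; rewrite invr_ge0 ltW.
have x2u2 : `|x2 - u2| <= e.
  apply: le_trans yb; rewrite bE2 [in leRHS](y_split _ x2 lam2_gt0).
  by apply: resolvent_nonexpansive opt2 sub2; rewrite invr_ge0 ltW.
have p2_close : lam2^-1 * `|lam2 *: (y - x2) - p2| <= e.
  apply: le_trans yb; rewrite bE2 [in leRHS](y_split _ x2 lam2_gt0).
  by apply: yosida_nonexpansive opt2 sub2; rewrite invr_ge0 ltW.
exists p2, (u2 - u1); split=> //.
  rewrite -(ler_pM2l (_ : 0 < lam2^-1)) ?invr_gt0// (le_trans p2_close)//.
  by rewrite ge_min lexx orbT.
have er : e <= r / 2 by rewrite ge_min lexx.
rewrite opprD addrACA -opprD (splitr r) (le_trans (ler_normB _ _))// lerD//.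
  exact: le_trans x2u2 er.
exact: le_trans x1u1 er.
Qed.

End nestedness.

Theorem mainTheorem19 (R : realType) (y : R -> R) (lam : nat -> R)
  (xs : nat -> R -> R) (xl : nat -> R -> R) :
  inL2 y ->
  (forall k, 0 < lam k) ->
  (forall k, lam k <= lam k.+1) ->
  (* MHDM iterates *)
  is_minimizer (lam 0%N) y (fun _ => 0) (xs 0%N) ->
  (forall k, is_minimizer (lam k.+1) y (xs k) (xs k.+1)) ->
  (* TV-denoising minimizers x_{lam k} *)
  (forall k, is_minimizer (lam k) y (fun _ => 0) (xl k)) ->
  forall k, {ae (@lebesgue_measure R), forall t, I01 t -> xs k t = xl k t}.
Proof.
move=> iy lam_gt0 lam_nd xs0_min xs_min xl_min k.
have ixs i : inL2 (xs i) by case: i => [|i]; [case: xs0_min|case: (xs_min i)].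
have ixl i : inL2 (xl i) by case: (xl_min i).
pose Y := toL2 y; pose X i := toL2 (xs i); pose Xl i := toL2 (xl i).
have tv_opt x i : inL2 x -> is_minimizer (lam i) y (fun=> 0) x ->
    subgradient (@test_derivatives R) (lam i *: (Y - toL2 x)) (toL2 x).
  rewrite -{1}(toL2K iy) => ix; rewrite -{1}(toL2K ix).
  by move=> /(is_minimizer_subgradient (z := 0) (lam_gt0 i)); rewrite subr0.
have mhdm_opt i : subgradient (@test_derivatives R)
    (lam i.+1 *: (Y - X i.+1)) (X i.+1 - X i).
  by apply: is_minimizer_subgradient => //; rewrite !toL2K.
have XXl : `|X k - Xl k| = 0.
  elim: k => [|k IH].
    by apply: (optimality_unique (z := 0) (z' := 0) (lam_gt0 0%N));
      rewrite ?subr0 ?normr0//; exact: tv_opt.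
  apply: (optimality_unique (lam_gt0 k.+1) IH (mhdm_opt k)).
  by apply: (subgradient_nested (lam_gt0 k) (lam_nd k)); exact: tv_opt.
have := L2_norm_eq0_ae XXl.
apply: filterS; first exact: (ae_filter_ringOfSetsType (@lebesgue_measure R)).
move=> t eq_t It; apply/eqP; rewrite -subr_eq0; apply/eqP; rewrite -(eq_t It).
by rewrite L2_subE !toL2K.
Qed.
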